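(* Let $\theta,\sigma>0$, $\mu_k>0$, $q_k>0$, $u_k(0)\in\mathbb{R}$, let $\xi_k$ ($k\ge1$) be i.i.d. standard normal random variables, and let $$u_k(t)=u_k(0)e^{-\theta\mu_kt}+\frac{\sigma q_k}{\theta\mu_k}\big(1-e^{-\theta\mu_kt}\big)\xi_k .$$ For $t>0$ put $U_k(t)=u_k(t)-u_k(0)$, $S_k(t)=1-e^{-\theta\mu_kt}$, and $$X_k=\frac{\theta\mu_kU_k(t)}{q_kS_k(t)},\qquad k=1,\dots,N,$$ so that, for all $t>0$, the random variables $X_1,\dots,X_N$ are i.i.d. Gaussian with mean $0$ and variance $\vartheta=\sigma^2$. Then the maximum likelihood estimator of $\vartheta$ is $$\hat\vartheta_N=\frac1N\sum_{k=1}^NX_k^2,$$ and it has the following properties: (1) it is the minimal variance unbiased estimator of $\vartheta$; (2) it is strongly consistent: $\lim_{N\to\infty}\hat\vartheta_N=\sigma^2$ with probability one; (3) it is asymptotically normal: $\lim_{N\to\infty}\sqrt N(\hat\vartheta_N-\sigma^2)=\mathcal N(0,2\sigma^4)$ in distribution.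
   Context: The $u_k(t)$ are the Fourier coefficients of the solution of $\dot u+\theta Au=\sigma\sum_k q_k\xi_kh_k$ in a Hilbert space, with $Ah_k=\mu_kh_k$ and $\{h_k\}$ a complete orthonormal system. The quantities $\theta\mu_k$ can be determined exactly from the observed $u_k$ at a few time points, so $X_1,\dots,X_N$ are assumed observable, and the estimator is based on them. $\mathcal N(0,2\sigma^4)$ is a Gaussian random variable with mean zero and variance $2\sigma^4$.
   Formalization: X_k as printed has mean -θμ_k u_k(0)/q_k, so the claim fails if u_k(0)≠0; it is proved for all u_k(0)=0, and for any u_k(0) with U_k(t)=u_k(t)-u_k(0)e^{-θμ_k t}. The likelihood maximizer is asserted for almost every sample. *)

(* Defs.v *)
From HB Require Import structures.
From mathcomp Require Import all_boot all_order all_algebra.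
From mathcomp Require Import finmap.
From mathcomp Require Import all_classical all_reals all_analysis.
From mathcomp Require Import measurable_realfun.
From mathcomp Require Import ring.

Set Implicit Arguments.
Unset Strict Implicit.
Unset Printing Implicit Defensive.

Import Order.TTheory GRing.Theory Num.Theory.
Import numFieldNormedType.Exports.

Local Open Scope classical_set_scope.
Local Open Scope ring_scope.

Section probability_notions.
Context {d : measure_display} {Omega : measurableType d} {R : realType}.
Variable P : probability Omega R.

Definition mutually_independent (X : nat -> {RV P >-> R}) : Prop :=
  forall (J : {fset nat}) (B : nat -> set R),
    (forall k, measurable (B k)) ->
    P (\bigcap_(k in [set` J]) (X k @^-1` B k)) =
    (\prod_(k <- J) P (X k @^-1` B k))%E.

(* Laws are compared on measurable sets only: the values of a measure on other
   sets are meaningless. *)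
Definition has_law (X : {RV P >-> R}) (m : set R -> \bar R) : Prop :=
  forall A : set R, measurable A -> distribution P X A = m A.

Definition iid (X : nat -> {RV P >-> R}) (m : set R -> \bar R) : Prop :=
  mutually_independent X /\ forall k, has_law (X k) m.

Definition cvg_in_distribution (Y : nat -> {RV P >-> R})
    (m : set R -> \bar R) : Prop :=
  forall x : R, {for x, continuous (fun r : R => m `]-oo, r]%classic)} ->
    cdf (Y n) x @[n --> \oo] --> m `]-oo, x]%classic.

End probability_notions.

Arguments mutually_independent {d Omega R} P X.
Arguments has_law {d Omega R} P X m.
Arguments iid {d Omega R} P X m.
Arguments cvg_in_distribution {d Omega R} P Y m.

Section samples.
Context {d : measure_display} {Omega : measurableType d} {R : realType}.

Definition sample (X : nat -> {mfun Omega >-> R}) (N : nat) (w : Omega) :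
  N.-tuple R := [tuple X i w | i < N].

Lemma measurable_sample (X : nat -> {mfun Omega >-> R}) (N : nat) :
  measurable_fun setT (sample X N).
Proof.
apply/measurable_fun_tnthP => i.
rewrite (_ : _ \o _ = X i) //.
by apply/funext => w /=; rewrite tnth_mktuple.
Qed.

HB.instance Definition _ (X : nat -> {mfun Omega >-> R}) (N : nat) :=
  isMeasurableFun.Build _ _ _ _ (sample X N) (@measurable_sample X N).

End samples.

(* A statistical model is a family of laws [Q v], v in [Theta], on the sample
   space [S]; an estimator of the parameter is a measurable map S -> R. *)
Section estimation.
Context {d : measure_display} {S : measurableType d} {R : realType}.
Variables (Theta : set R) (Q : R -> probability S R).

Definition unbiased (T : S -> R) : Prop :=
  forall v, Theta v ->
    (Q v).-integrable setT (EFin \o T) /\ ('E_(Q v)[T] = v%:E)%E.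

(* ['V_(Q v)[T']] is +oo when [T'] is not square-integrable. *)
Definition minimal_variance_unbiased (T : S -> R) : Prop :=
  [/\ measurable_fun setT T,
      unbiased T &
      forall T' : S -> R, measurable_fun setT T' -> unbiased T' ->
        forall v, Theta v -> ('V_(Q v)[T] <= 'V_(Q v)[T'])%E].

Definition is_the_mvue (T : S -> R) : Prop :=
  minimal_variance_unbiased T /\
  forall T' : S -> R, minimal_variance_unbiased T' ->
    forall v, Theta v -> {ae Q v, forall x, T' x = T x}.

(* [L v x] is the likelihood of the parameter [v] given the sample [x]. The
   maximizer need only exist for almost every sample: for centered Gaussian
   data, the likelihood of the zero sample is unbounded. *)
Definition is_the_mle (L : R -> S -> R) (T : S -> R) : Prop :=
  measurable_fun setT T /\
  forall v, Theta v -> {ae Q v, forall x,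
    Theta (T x) /\
    forall v', Theta v' -> v' != T x -> L v' x < L (T x) x}.

End estimation.

Section estimators.
Context {R : realType}.

Definition iid_likelihood (f : R -> R -> R) (N : nat) (v : R)
    (x : N.-tuple R) : R :=
  \prod_(i < N) f v (tnth x i).

Definition variance_estimator (N : nat) (x : N.-tuple R) : R :=
  N%:R^-1 * \sum_(i < N) tnth x i ^+ 2.

Lemma measurable_variance_estimator (N : nat) :
  measurable_fun setT (@variance_estimator N).
Proof.
apply: measurable_funM => //; apply: measurable_sum => i.
by apply: measurable_funX; exact: measurable_tnth.
Qed.

End estimators.

(* All sequences are indexed from 0: index [k] stands for [k + 1] in the usual
   numbering of the Fourier modes. *)
Section fourier_modes.
Context {d : measure_display} {Omega : measurableType d} {R : realType}.
Variables (theta : R) (mu q u0 : nat -> R) (xi : nat -> {mfun Omega >-> R}).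
Variables (sigma t : R) (k : nat).

Definition fourier_coef (w : Omega) : R :=
  u0 k * expR (- (theta * mu k * t)) +
  sigma * q k / (theta * mu k) * (1 - expR (- (theta * mu k * t))) * xi k w.

Definition relaxation : R := 1 - expR (- (theta * mu k * t)).

Definition observation_of (U : Omega -> R) (w : Omega) : R :=
  theta * mu k * U w / (q k * relaxation).

Definition increment (w : Omega) : R := fourier_coef w - u0 k.

Definition observation : Omega -> R := observation_of increment.

(* The increment [u_k(t) - u_k(0)] carries the initial value: the observation
   built on it has mean [- theta * mu k * u0 k / q k], see [observationE]. It is
   centered only when [u0 k = 0]; for an arbitrary initial value one has to
   subtract the free evolution of the mode instead of [u0 k]. *)
Definition centered_increment (w : Omega) : R :=
  fourier_coef w - u0 k * expR (- (theta * mu k * t)).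

Definition centered_observation : Omega -> R :=
  observation_of centered_increment.

Lemma relaxation_neq0 : 0 < theta -> 0 < mu k -> 0 < t -> relaxation != 0.
Proof.
move=> theta0 mu0 t0; rewrite subr_eq0 eq_sym lt_eqF// expR_lt1 oppr_lt0.
by rewrite !mulr_gt0.
Qed.

Lemma observationE (w : Omega) :
  0 < theta -> 0 < mu k -> 0 < q k -> 0 < t ->
  observation w = sigma * xi k w - theta * mu k * u0 k / q k.
Proof.
move=> theta0 mu0 q0 t0; have := relaxation_neq0 theta0 mu0 t0.
rewrite /observation /observation_of /increment /fourier_coef /relaxation.
move: (expR _) (xi k w) theta0 mu0 q0 => E x theta0 mu0 q0 E1.
by field; rewrite E1 !gt_eqF.
Qed.

Lemma centered_observationE (w : Omega) :
  0 < theta -> 0 < mu k -> 0 < q k -> 0 < t ->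
  centered_observation w = sigma * xi k w.
Proof.
move=> theta0 mu0 q0 t0; have := relaxation_neq0 theta0 mu0 t0.
rewrite /centered_observation /observation_of /centered_increment.
rewrite /fourier_coef /relaxation.
move: (expR _) (xi k w) theta0 mu0 q0 => E x theta0 mu0 q0 E1.
by field; rewrite E1 !gt_eqF.
Qed.

Lemma measurable_fourier_coef : measurable_fun setT fourier_coef.
Proof. by apply: measurable_funD => //; exact: measurable_funM. Qed.

Lemma measurable_observation_of (U : Omega -> R) :
  measurable_fun setT U -> measurable_fun setT (observation_of U).
Proof. by move=> mU; apply: measurable_funM => //; exact: measurable_funM. Qed.

Lemma measurable_observation : measurable_fun setT observation.
Proof.
apply: measurable_observation_of.
by apply: measurable_funB => //; exact: measurable_fourier_coef.
Qed.

Lemma measurable_centered_observation :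
  measurable_fun setT centered_observation.
Proof.
apply: measurable_observation_of.
by apply: measurable_funB => //; exact: measurable_fourier_coef.
Qed.

HB.instance Definition _ :=
  isMeasurableFun.Build _ _ _ _ observation measurable_observation.
HB.instance Definition _ :=
  isMeasurableFun.Build _ _ _ _ centered_observation
    measurable_centered_observation.

End fourier_modes.

Section normalized_error.
Context {d : measure_display} {Omega : measurableType d} {R : realType}.
Variables (X : nat -> {mfun Omega >-> R}) (v : R) (N : nat).

Definition normalized_error (w : Omega) : R :=
  Num.sqrt N%:R * (variance_estimator (sample X N w) - v).

Lemma measurable_normalized_error : measurable_fun setT normalized_error.
Proof.
apply: measurable_funM => //; apply: measurable_funB => //.
apply: (measurableT_comp (@measurable_variance_estimator R N)).
exact: measurable_sample.
Qed.

HB.instance Definition _ :=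
  isMeasurableFun.Build _ _ _ _ normalized_error measurable_normalized_error.

End normalized_error.

(* Main.v *)
(* Everything rests on one change of variables: if [xi] is a standard Gaussian
   sample of size [n], then the law of [a * xi] has density
   [a^-n * exp((1 - a^-2)/2 * |xi|^2)] with respect to that of [xi].

   - Integrating the constant 1 gives [E exp(c |xi|^2)] for [c < 1/2]; Chernoff's
     bound and Borel-Cantelli then yield strong consistency. Differentiating at
     [a = 1] against a power gives the even Gaussian moments.
   - If [D] is the difference of two unbiased estimators then [E D(s a xi) = 0]
     for all [a > 0]; differentiating at [a = 1] gives [E (D(s xi) |xi|^2) = 0],
     so that [D] is uncorrelated with the estimator [|X|^2 / n]. Hence the
     variance of any unbiased estimator exceeds that of [|X|^2 / n] by [E D^2],
     which gives both minimality and uniqueness.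
   - The likelihood at [v] depends on the sample only through [T = |X|^2 / n],
     and comparing [v] with [T] reduces to [r < exp(r - 1)] for [r = T / v <> 1].
   - Asymptotic normality is Lindeberg's argument in operator form: with
     [(T_Y f)(x) = E f(x + Y)], the [n]-th powers of [T_Y] and [T_G], for a small
     summand [Y] and a Gaussian [G] with the same first two moments, differ by at
     most [n] times the third-order Taylor error. *)

Require Import Defs.
From HB Require Import structures.
From mathcomp Require Import all_boot all_order all_algebra.
From mathcomp Require Import finmap.
From mathcomp Require Import all_classical all_reals all_analysis.
From mathcomp Require Import measurable_realfun.
From mathcomp Require Import ring lra.

Import Order.TTheory GRing.Theory Num.Theory.
Import numFieldNormedType.Exports.

Local Open Scope classical_set_scope.
Local Open Scope ring_scope.

(** * Densities and affine changes of variable *)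

(** Four choices shape the proof. All parameters are coupled on the given space: the sample of
    variance v is [Num.sqrt v] times one fixed sequence [xi], so varying the parameter is dilating
    the sample. An unbiased estimator is merely integrable at each parameter, which gives no control
    on derivatives of its mean; the dilation factors therefore tend to 1 from below, where the tilt
    is, up to a constant, the bounded weight exp(- c |xi|^2), whose difference quotient is dominated
    by |xi|^2. What must then be known is the integrability of D |xi|^2; it follows from
    square-integrability, estimators of infinite variance being trivial competitors. Identities are
    proved first for nonnegative extended-real functions, with no integrability to carry, and reach
    signed functions through positive and negative parts. In the limit theorem, test functions take
    values in [0, 1], so that they stay integrable under every convolution; smooth steps from 1 to 0
    then recover distribution functions. *)

Section density.
Local Open Scope ereal_scope.
Context {d : measure_display} {T : measurableType d} {R : realType}.
Import HBNNSimple.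

(** The hypothesis covers indicators; linearity gives simple functions, and monotone convergence
    along [nnsfun_approx] carries the identity to [f]. *)
Lemma ge0_integral_density (mu nu : {measure set T -> \bar R}) (g : T -> R)
    (f : T -> \bar R) :
  measurable_fun setT g -> (forall x, (0 <= g x)%R) ->
  (forall A, measurable A -> nu A = \int[mu]_(x in A) (g x)%:E) ->
  measurable_fun setT f -> (forall x, 0 <= f x) ->
  \int[nu]_x f x = \int[mu]_x (f x * (g x)%:E).
Proof.
move=> mg g0 nuE mf f0; pose h := nnsfun_approx measurableT mf.
have mEg : measurable_fun setT (EFin \o g) by exact/measurable_EFinP.
have hf x : f x = limn (fun n => (h n x)%:E).
  by apply/esym/cvg_lim => //; exact: cvg_nnsfun_approx.
have hfg x : f x * (g x)%:E = limn (fun n => (h n x)%:E * (g x)%:E).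
  apply/esym/cvg_lim => //; apply: cvgeZr => //.
  exact: cvg_nnsfun_approx.
under eq_integral do rewrite hf.
under [RHS]eq_integral do rewrite hfg.
rewrite !monotone_convergence//=; last 6 first.
- by move=> n; apply: emeasurable_funM => //; exact/measurable_EFinP.
- by move=> n x _; rewrite mule_ge0// lee_fin.
- move=> x _ a b ab; rewrite lee_wpmul2r ?lee_fin//.
  exact/lefP/nd_nnsfun_approx.
- by move=> n; exact/measurable_EFinP.
- by move=> n x _; rewrite lee_fin.
- by move=> x _ a b ab; rewrite lee_fin; exact/lefP/nd_nnsfun_approx.
congr (limn _); apply/funext => n.
have mind r : measurable_fun setT (fun x => (r * \1_(h n @^-1` [set r]) x)%:E).
  by apply/measurable_EFinP; exact: measurable_funM.
transitivity (\int[nu]_x (\sum_(r \in range (h n))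
    (r * \1_(h n @^-1` [set r]) x)%:E)).
  by apply: eq_integral => x _; rewrite fimfunE -fsumEFin.
rewrite ge0_integral_fsum//; last by move=> r x _; exact: nnfun_muleindic_ge0.
transitivity (\int[mu]_x (\sum_(r \in range (h n))
    (r * \1_(h n @^-1` [set r]) x)%:E * (g x)%:E)); last first.
  apply: eq_integral => x _.
  rewrite -ge0_mule_fsuml => [|r]; last exact: nnfun_muleindic_ge0.
  by rewrite fimfunE -fsumEFin.
rewrite ge0_integral_fsum//; last 2 first.
- by move=> r; exact: emeasurable_funM.
- by move=> r x _; rewrite mule_ge0 ?nnfun_muleindic_ge0 ?lee_fin.
apply: eq_fsbigr => r rh.
have r0 : (0 <= r)%R by move: rh; rewrite inE => -[x _ <-].
under eq_integral do rewrite EFinM.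
under [RHS]eq_integral do rewrite EFinM -muleA.
rewrite ge0_integralZl//; last exact/measurable_EFinP.
rewrite ge0_integralZl//; last 2 first.
- by apply: emeasurable_funM => //; exact/measurable_EFinP.
- by move=> x _; rewrite mule_ge0// lee_fin.
rewrite integral_indic// setIT nuE// integral_mkcond.
congr (_ * _); apply: eq_integral => x _.
by rewrite patchE indicE; case: ifPn => xr; rewrite ?mul1e ?mul0e.
Qed.

End density.

Section affine_change_of_variable.
Context {R : realType}.
Notation mu := (@lebesgue_measure R).

(** Uniqueness of Lebesgue measure: [a] times the image of [mu] under the affine map agrees with
    [mu] on the intervals ]u, v]. *)
Lemma lebesgue_measure_affine (a b : R) (A : set R) : 0 < a -> measurable A ->
  mu ((fun x => a * x + b) @^-1` A) = (a^-1%:E * mu A)%E.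
Proof.
move=> a0 mA.
pose F (x : measurableTypeR R) : measurableTypeR R := a * x + b.
have mF : measurable_fun setT F.
  by apply: measurable_funD => //; exact: measurable_funM.
have a0' : 0 <= a by exact: ltW.
pose m : {measure set (measurableTypeR R) -> \bar R} :=
  mscale (NngNum a0') (pushforward mu F).
have mE : mu A = m mF A.
  apply: (@lebesgue_measure_unique _ (m mF)) => //= _ [[u v]] _ <-.
  rewrite /m /mscale/= /pushforward.
  rewrite (_ : _ @^-1` _ = `](u - b) / a, (v - b) / a]%classic); last first.
    apply/seteqP; split => x /=; rewrite !in_itv/= ltr_pdivrMr// ler_pdivlMr//;
    by rewrite ltrBlDr lerBrDr mulrC.
  rewrite !lebesgue_measure_itv/= !lte_fin ltr_pM2r ?invr_gt0// ltrD2r.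
  case: ifPn => _; rewrite ?mule0// -EFinD -!EFinM; congr EFin.
  by field; rewrite gt_eqF.
rewrite mE /m /mscale/= muleA -EFinM mulVf ?gt_eqF// mul1e.
by [].
Qed.

Lemma ge0_integral_affine (a b : R) (f : R -> \bar R) : 0 < a ->
  measurable_fun setT f -> (forall x, 0 <= f x)%E ->
  (\int[mu]_x f (a * x + b)%R = a^-1%:E * \int[mu]_x f x)%E.
Proof.
move=> a0 mf f0.
pose F (x : measurableTypeR R) : measurableTypeR R := a * x + b.
have mF : measurable_fun setT F.
  by apply: measurable_funD => //; exact: measurable_funM.
have a0' : 0 <= a^-1 by rewrite invr_ge0 ltW.
have := @ge0_integral_pushforward _ _ (measurableTypeR R)
  (measurableTypeR R) R F mF lebesgue_measure setT f measurableT mf (fun x _ => f0 x).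
rewrite preimage_setT /comp /F => <-.
rewrite (eq_measure_integral (mscale (NngNum a0') (@lebesgue_measure R))); last first.
  by move=> A mA _; rewrite /= /mscale/= -(lebesgue_measure_affine a b).
by rewrite ge0_integral_mscale.
Qed.

End affine_change_of_variable.

(** * Gaussian integrals *)

Section gaussian.
Context {R : realType}.
Notation mu := (@lebesgue_measure R).
Local Open Scope ereal_scope.

Lemma ge0_integral_normal_prob (m s : R) (f : R -> \bar R) :
  measurable_fun setT f -> (forall x, 0 <= f x) ->
  \int[normal_prob m s]_x f x = \int[mu]_x (f x * (normal_pdf m s x)%:E).
Proof.
move=> mf f0; apply: ge0_integral_density => //.
- exact: measurable_normal_pdf.
- exact: normal_pdf_ge0.
Qed.

(** Gaussians form a location-scale family; the factor [a] is the Jacobian that the change of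
    variables in Lebesgue measure absorbs. *)
Lemma normal_pdf_affine (a b m s x : R) : (0 < a)%R -> (0 < s)%R ->
  normal_pdf m s x = (a * normal_pdf (a * m + b) (a * s) (a * x + b))%R.
Proof.
move=> a0 s0; rewrite !normal_pdfE ?gt_eqF ?mulr_gt0// /normal_fun/normal_peak.
rewrite (_ : ((a * s) ^+ 2 * pi *+ 2 = a ^+ 2 * (s ^+ 2 * pi *+ 2))%R); last by ring.
rewrite sqrtrM ?sqr_ge0// sqrtr_sqr gtr0_norm// invfM !mulrA mulfV ?gt_eqF// mul1r.
by congr (_ * expR _)%R; field; rewrite !gt_eqF.
Qed.

Lemma ge0_integral_normal_prob_affine (a b m s : R) (f : R -> \bar R) :
  (0 < a)%R -> (0 < s)%R ->
  measurable_fun setT f -> (forall x, 0 <= f x) ->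
  \int[normal_prob m s]_x f (a * x + b)%R =
  \int[normal_prob (a * m + b) (a * s)]_x f x.
Proof.
move=> a0 s0 mf f0.
rewrite (ge0_integral_normal_prob (a * m + b) (a * s)); [|exact: mf|exact: f0].
rewrite (ge0_integral_normal_prob m s); last 2 first.
- by apply: (measurableT_comp mf); exact: measurable_funD.
- by move=> x; exact: f0.
pose g x := f x * (a * normal_pdf (a * m + b) (a * s) x)%:E.
have mpdf := measurable_normal_pdf (a * m + b) (a * s).
transitivity (\int[mu]_x g (a * x + b)%R).
  by apply: eq_integral => x _; rewrite /g -normal_pdf_affine.
rewrite ge0_integral_affine//; last 2 first.
- apply: emeasurable_funM => //; apply/measurable_EFinP.
  exact: measurable_funM.
- by move=> x; rewrite mule_ge0// lee_fin mulr_ge0 ?normal_pdf_ge0// ltW.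
rewrite -ge0_integralZl//.
- apply: eq_integral => x _; rewrite /g muleCA; congr (_ * _).
  by rewrite -EFinM mulKf// gt_eqF.
- apply: emeasurable_funM => //; apply/measurable_EFinP.
  exact: measurable_funM.
- by move=> x _; rewrite mule_ge0// lee_fin mulr_ge0 ?normal_pdf_ge0// ltW.
- by rewrite lee_fin invr_ge0 ltW.
Qed.

Lemma ge0_integral_normal_prob_scale (a s : R) (f : R -> \bar R) :
  (0 < a)%R -> (0 < s)%R ->
  measurable_fun setT f -> (forall x, 0 <= f x) ->
  \int[normal_prob 0 s]_x f (a * x)%R = \int[normal_prob 0 (a * s)]_x f x.
Proof.
move=> a0 s0 mf f0.
have := ge0_integral_normal_prob_affine a 0 0 s f a0 s0 mf f0.
by rewrite mulr0 addr0 => <-; apply: eq_integral => x _; rewrite addr0.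
Qed.

(* Tilting a centered Gaussian density by a quadratic exponential only changes
   its variance. *)
Lemma ge0_integral_normal_prob_tilt (a : R) (f : R -> \bar R) : (0 < a)%R ->
  measurable_fun setT f -> (forall x, 0 <= f x) ->
  \int[normal_prob 0 1]_x f (a * x)%R =
  \int[normal_prob 0 1]_x (f x * (a^-1 * expR ((1 - a ^- 2) / 2 * x ^+ 2))%:E).
Proof.
move=> a0 mf f0; rewrite ge0_integral_normal_prob_scale ?mulr1;
  [|exact: a0|exact: ltr01|exact: mf|exact: f0].
have mw : measurable_fun setT
    (fun x : R => (a^-1 * expR ((1 - a ^- 2) / 2 * x ^+ 2))%R).
  apply: measurable_funM => //; apply: measurableT_comp => //.
  exact: measurable_funM.
have w0 (x : R) : (0 <= a^-1 * expR ((1 - a ^- 2) / 2 * x ^+ 2))%R.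
  by rewrite mulr_ge0 ?expR_ge0// invr_ge0 ltW.
rewrite (ge0_integral_normal_prob 0 a); [|exact: mf|exact: f0].
rewrite (ge0_integral_normal_prob 0 1); last 2 first.
- by apply: emeasurable_funM => //; exact/measurable_EFinP.
- by move=> x; rewrite mule_ge0// lee_fin.
apply: eq_integral => x _; rewrite -muleA -EFinM; congr (_ * (_)%:E).
rewrite !normal_pdfE ?gt_eqF ?oner_eq0// /normal_fun /normal_peak.
rewrite !subr0 expr1n mul1r.
rewrite (_ : (a ^+ 2 * pi *+ 2 = a ^+ 2 * (pi *+ 2))%R); last by ring.
rewrite sqrtrM ?sqr_ge0// sqrtr_sqr gtr0_norm// invfM.
rewrite -!mulrA; congr (_ * _)%R; rewrite mulrCA; congr (_ * _)%R.
rewrite -expRD; congr expR; field.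
by rewrite gt_eqF.
Qed.

End gaussian.

(** * Independence *)

Section laws.
Context {d : measure_display} {Omega : measurableType d} {R : realType}.
Variable P : probability Omega R.
Local Open Scope ereal_scope.

Lemma ge0_integral_normal_law (X : {RV P >-> R}) (m s : R) (f : R -> \bar R) :
  has_law P X (normal_prob m s) ->
  measurable_fun setT f -> (forall x, 0 <= f x) ->
  \int[P]_w f (X w) = \int[normal_prob m s]_x f x.
Proof.
move=> lX mf f0.
have mX : measurable_fun setT (X : Omega -> measurableTypeR R).
  by move=> _ A mA; exact: (measurable_funP X).
have := @ge0_integral_pushforward _ _ Omega (measurableTypeR R) R X mX P setT f
  measurableT mf (fun x _ => f0 x).
rewrite preimage_setT => <-.
by apply: eq_measure_integral => A mA _; exact: lX.
Qed.

Lemma has_law_scale (X Y : {RV P >-> R}) (a s : R) :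
  (0 < a)%R -> (0 < s)%R -> (forall w, Y w = a * X w)%R ->
  has_law P X (normal_prob 0 s) -> has_law P Y (normal_prob 0 (a * s)).
Proof.
move=> a0 s0 YE lX A mA.
have mI : measurable_fun setT (fun x : R => (\1_A x : R)%:E).
  by apply/measurable_EFinP; exact: measurable_indic.
have I0 (x : R) : 0 <= (\1_A x : R)%:E by rewrite lee_fin.
transitivity (\int[normal_prob 0 (a * s)]_x (\1_A x : R)%:E); last first.
  by rewrite integral_indic// setIT.
rewrite -(ge0_integral_normal_prob_scale _ _ _ a0 s0 mI I0).
rewrite -(ge0_integral_normal_law _ _ _ (fun x => (\1_A (a * x) : R)%:E) lX); last 2 first.
- by apply: (measurableT_comp mI); exact: measurable_funM.
- by move=> x; rewrite lee_fin.
rewrite (_ : distribution P Y A = \int[P]_w (\1_(Y @^-1` A) w : R)%:E); last first.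
  rewrite integral_indic ?setIT//.
  by rewrite -[X in measurable X]setTI; exact: measurable_funPT.
by apply: eq_integral => w _; rewrite !indicE -YE.
Qed.

Lemma mutually_independent_comp (X Y : nat -> {RV P >-> R}) (g : nat -> R -> R) :
  (forall k, measurable_fun setT (g k)) -> (forall k w, Y k w = g k (X k w)) ->
  mutually_independent P X -> mutually_independent P Y.
Proof.
move=> mg YE iX J B mB.
have E k : Y k @^-1` B k = X k @^-1` (g k @^-1` B k).
  by apply/seteqP; split => w /=; rewrite YE.
under eq_bigcapr do rewrite E.
under eq_bigr do rewrite E.
apply: iX => k; rewrite -[X in measurable X]setTI; exact: mg.
Qed.

End laws.

Section independence.
Context {d : measure_display} {Omega : measurableType d} {R : realType}.
Variable P : probability Omega R.
Local Open Scope ereal_scope.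

(** Factorization on rectangles identifies the joint law of [U] and [V] with a product measure, and
    Tonelli applies. Drawing the second variable from a second copy of [Omega] lets later inductions
    stay on [P]. *)
Lemma ge0_integral_independent {d1 d2} {T1 : measurableType d1}
    {T2 : measurableType d2} (U : {mfun Omega >-> T1}) (V : {mfun Omega >-> T2})
    (f : T1 * T2 -> \bar R) :
  (forall A B, measurable A -> measurable B ->
    P (U @^-1` A `&` V @^-1` B) = P (U @^-1` A) * P (V @^-1` B)) ->
  measurable_fun setT f -> (forall x, 0 <= f x) ->
  \int[P]_w f (U w, V w) = \int[P]_w \int[P]_w' f (U w, V w').
Proof.
move=> iUV mf f0.
have mUV : measurable_fun setT (fun w => (U w, V w)).
  exact: measurable_fun_pair.
pose PU : probability T1 R := distribution P U.
pose PV : probability T2 R := distribution P V.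
pose PP m : {measure set (T1 * T2) -> \bar R} :=
  distribution P (HB.pack_for {mfun Omega >-> (T1 * T2)%type}
    (fun w => (U w, V w)) (isMeasurableFun.Build _ _ _ _ _ m)).
have PPE := @product_measure_unique _ _ _ _ _ PU PV (PP mUV).
transitivity (\int[PP mUV]_z f z).
  by rewrite ge0_integral_distribution.
rewrite (eq_measure_integral (PU \x PV)); last first.
  by move=> A mA _; apply/esym/PPE => // B C mB mC; exact: iUV.
rewrite fubini_tonelli1// ge0_integral_distribution//=; last 2 first.
- exact: measurable_fun_fubini_tonelli_F.
- by move=> x; exact: integral_ge0.
apply: eq_integral => w _ /=; rewrite /fubini_F ge0_integral_distribution//.
exact: measurableT_comp.
Qed.

(** Boxes are stable under intersection and generate the product sigma-algebra: a coordinate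
    cylinder is a box whose other sides are full, and a box is a finite intersection of
    cylinders. *)
Lemma tuple_measure_unique {dT} {T : measurableType dT} (n : nat)
    (m1 m2 : {measure set (n.-tuple T) -> \bar R}) :
  m1 setT < +oo ->
  (forall B : 'I_n -> set T, (forall i, measurable (B i)) ->
    m1 [set x | forall i, B i (tnth x i)] =
    m2 [set x | forall i, B i (tnth x i)]) ->
  forall A, measurable A -> m1 A = m2 A.
Proof.
move=> m1oo m12.
pose G : set (set (n.-tuple T)) := [set A | exists2 B : 'I_n -> set T,
  forall i, measurable (B i) & A = [set x | forall i, B i (tnth x i)]].
have GT : G setT.
  by exists (fun=> setT) => //; apply/seteqP; split.
apply: (measure_unique G (fun=> setT)) => //.
- apply/seteqP; split.
    apply: smallest_sub; first exact: smallest_sigma_algebra.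
    move=> A; rewrite -bigcup_seq => -[/= i _ [B mB <-]].
    apply: sub_sigma_algebra; exists (fun j => if j == i then B else setT).
      by move=> j; case: ifPn.
    rewrite setTI; apply/seteqP; split => x /=.
      by move=> Bx j; case: eqP => // ->.
    by move=> /(_ i); rewrite eqxx.
  apply: smallest_sub; first exact: sigma_algebra_measurable.
  move=> _ [B mB ->].
  rewrite (_ : [set x | _] = \big[setI/setT]_(i < n) ((@tnth _ T ^~ i) @^-1` B i)).
    apply: bigsetI_measurable => i _; rewrite -[X in measurable X]setTI.
    exact: measurable_tnth.
  rewrite -bigcap_seq; apply/seteqP; split => x /=; first by move=> Bx i _.
  move=> Bx i; exact: (Bx i (mem_index_enum i)).
- move=> _ _ [B1 mB1 ->] [B2 mB2 ->]; exists (fun i => B1 i `&` B2 i).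
    by move=> i; exact: measurableI.
  apply/seteqP; split => x /=; first by move=> [h1 h2] i; split.
  by move=> h; split => i; have [] := h i.
- by rewrite bigcup_const.
- by move=> A [B mB ->]; exact: m12.
Qed.

End independence.

Section iid_samples.
Context {d : measure_display} {Omega : measurableType d} {R : realType}.
Variable P : probability Omega R.
Local Open Scope ereal_scope.

(** Trades finite sets of indices for an initial segment, the form from which the first variable can
    be split off. *)
Lemma mutually_independent_initial (X : nat -> {RV P >-> R}) (n : nat)
    (B : nat -> set R) :
  mutually_independent P X -> (forall k, measurable (B k)) ->
  P [set w | forall k, (k < n)%N -> B k (X k w)] =
  \prod_(k < n) P (X k @^-1` B k).
Proof.
move=> iX mB; have := iX [fset k in iota 0 n]%fset B mB.
rewrite (_ : \bigcap_(k in _) _ = [set w | forall k, (k < n)%N -> B k (X k w)]).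
  move=> ->; rewrite (perm_big (iota 0 n)) /=.
    by rewrite -[in iota 0 n](subn0 n) -/(index_iota 0 n) big_mkord.
  apply: uniq_perm; rewrite ?fset_uniq ?iota_uniq// => k.
  by rewrite in_fset_.
apply/seteqP; split => w /= Bw k.
  by move=> kn; apply: Bw; rewrite /= in_fset_ mem_iota.
by move=> kn; apply: Bw; move: kn; rewrite /= in_fset_ mem_iota.
Qed.

Lemma mutually_independent_shift (X : nat -> {RV P >-> R}) :
  mutually_independent P X -> mutually_independent P (fun k => X k.+1).
Proof.
move=> iX J B mB.
have := iX [fset k.+1 | k in J]%fset (fun k => B k.-1) (fun k => mB _).
rewrite big_imfset /=; last by move=> i j _ _ [].
move=> <-; congr (P _); apply/seteqP; split => w /= Bw k.
  by move=> /imfsetP[i iJ ->]; exact: Bw.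
by move=> kJ; apply: (Bw k.+1); apply/imfsetP; exists k.
Qed.

(** For fixed [A] both sides are finite measures in [B]: the law of the tail restricted to the event
    on the head, and a multiple of the law of the tail. It suffices to compare them on boxes, where
    both are finite products. *)
Lemma independent_head_sample (X : nat -> {RV P >-> R}) (n : nat)
    (A : set R) (B : set (n.-tuple R)) :
  mutually_independent P X -> measurable A -> measurable B ->
  P (X 0%N @^-1` A `&` sample (fun k => X k.+1) n @^-1` B) =
  P (X 0%N @^-1` A) * P (sample (fun k => X k.+1) n @^-1` B).
Proof.
move=> iX mA mB; set Y := sample _ n.
have mXA : measurable (X 0%N @^-1` A).
  by rewrite -[X in measurable X]setTI; exact: measurable_funPT.
have pfin : P (X 0%N @^-1` A) \is a fin_num by exact: fin_num_measure.
pose m1 : {measure set (n.-tuple R) -> \bar R} :=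
  pushforward (mrestr P mXA) Y.
have p0 : (0 <= fine (P (X 0%N @^-1` A)))%R by rewrite fine_ge0.
pose m2 : {measure set (n.-tuple R) -> \bar R} :=
  mscale (NngNum p0) (distribution P Y).
have mY : measurable_fun setT Y by exact: measurable_sample.
have m12 : m1 mY B = m2 B.
  apply: tuple_measure_unique mB.
    by rewrite /m1/= /pushforward/mrestr preimage_setT setTI ltey_eq pfin.
  move=> C mC.
  (* [mutually_independent_initial] takes a family indexed by all of [nat]: beyond [n] the sides are
     the whole line. *)
  pose D k := if insub k is Some i then C i else setT.
  have mD k : measurable (D k) by rewrite /D; case: insubP.
  have YE : Y @^-1` [set x | forall i, C i (tnth x i)] =
      [set w | forall k, (k < n)%N -> D k (X k.+1 w)].
    apply/seteqP; split => w /= Cw i; last first.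
      by rewrite tnth_mktuple; have := Cw i (ltn_ord i); rewrite /D valK.
    move=> ilt; have := Cw (Ordinal ilt).
    by rewrite tnth_mktuple /D insubT.
  rewrite /m1 /m2 /= /mscale /= /distribution /pushforward /mrestr fineK// YE.
  have iX' := mutually_independent_shift _ iX.
  rewrite (mutually_independent_initial _ _ _ iX' mD).
  (* Prepending [A] to the box turns the joint event into an initial-segment event of length
     [n.+1]. *)
  have mE k : measurable (if k is k'.+1 then D k' else A) by case: k.
  have := mutually_independent_initial _ n.+1 _ iX mE.
  rewrite big_ord_recl => <-; congr (P _); apply/seteqP; split => w /=.
    by move=> [Dw Aw] [|k] // /Dw.
  move=> h; split; last exact: (h 0%N).
  by move=> k kn; exact: (h k.+1).
move: m12; rewrite /m1 /m2 /= /mscale /= /distribution /pushforward /mrestr fineK// => <-.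
by rewrite setIC.
Qed.

Lemma sample_cons (X : nat -> {RV P >-> R}) (n : nat) (w : Omega) :
  sample X n.+1 w = [tuple of X 0%N w :: sample (fun k => X k.+1) n w].
Proof.
apply: eq_from_tnth => i; rewrite tnth_mktuple.
case: (unliftP ord0 i) => [j|] ->; last by [].
by rewrite tnthS tnth_mktuple.
Qed.

Lemma ge0_integral_head_sample (X : nat -> {RV P >-> R}) (n : nat)
    (f : R * n.-tuple R -> \bar R) :
  mutually_independent P X -> measurable_fun setT f -> (forall x, 0 <= f x) ->
  \int[P]_w f (X 0%N w, sample (fun k => X k.+1) n w) =
  \int[P]_w \int[P]_w' f (X 0%N w, sample (fun k => X k.+1) n w').
Proof.
move=> iX mf f0.
apply: (ge0_integral_independent P (X 0%N) (sample (fun k => X k.+1) n)) => //.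
by move=> A B mA mB; exact: independent_head_sample.
Qed.

End iid_samples.

(** * Tilted Gaussian samples *)

Section tilted_samples.
Context {d : measure_display} {Omega : measurableType d} {R : realType}.
Variable P : probability Omega R.
Local Open Scope ereal_scope.

Definition sum_of_squares (n : nat) (x : n.-tuple R) : R :=
  (\sum_(i < n) tnth x i ^+ 2)%R.

Lemma measurable_sum_of_squares (n : nat) :
  measurable_fun setT (@sum_of_squares n).
Proof.
apply: measurable_sum => i.
by apply: measurable_funX; exact: measurable_tnth.
Qed.

Lemma sum_of_squares_ge0 (n : nat) (x : n.-tuple R) : (0 <= sum_of_squares n x)%R.
Proof. by apply: sumr_ge0 => i _; exact: sqr_ge0. Qed.

(* The density of the centered Gaussian law of variance [a ^+ 2] with respect to
   the standard one, on samples of size [n]. *)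
Definition tilt (n : nat) (a : R) (x : n.-tuple R) : R :=
  (a ^- n * expR ((1 - a ^- 2) / 2 * sum_of_squares n x))%R.

Lemma measurable_tilt (n : nat) (a : R) : measurable_fun setT (@tilt n a).
Proof.
apply: measurable_funM => //; apply: measurableT_comp => //.
by apply: measurable_funM => //; exact: measurable_sum_of_squares.
Qed.

Lemma tilt_gt0 (n : nat) (a : R) (x : n.-tuple R) :
  (0 < a)%R -> (0 < tilt n a x)%R.
Proof. by move=> a0; rewrite mulr_gt0 ?expR_gt0// invr_gt0 exprn_gt0. Qed.

Lemma tilt_cons (n : nat) (a x : R) (t : n.-tuple R) :
  tilt n.+1 a [tuple of x :: t] =
  (a^-1 * expR ((1 - a ^- 2) / 2 * x ^+ 2) * tilt n a t)%R.
Proof.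
rewrite /tilt /sum_of_squares big_ord_recl mulrDr expRD exprS invfM.
rewrite (_ : tnth _ ord0 = x)//.
under eq_bigr do rewrite tnthS.
by rewrite -!mulrA; congr (_ * _)%R; rewrite mulrCA.
Qed.

Lemma measurable_cons_pair (n : nat) :
  measurable_fun setT (fun z : R * n.-tuple R => [tuple of z.1 :: z.2]).
Proof. by apply: measurable_cons. Qed.

(** Induction on [n], the tilt being a product over the coordinates: with the head frozen, the tail
    is tilted by the induction hypothesis; then the head is tilted by the one-dimensional formula.
    Independence separates the two integrations. *)
Lemma ge0_integral_sample_tilt (n : nat) (a : R) (xi Y : nat -> {RV P >-> R})
    (f : n.-tuple R -> \bar R) :
  (0 < a)%R -> iid P xi (normal_prob 0 1) ->
  (forall k w, Y k w = a * xi k w)%R ->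
  measurable_fun setT f -> (forall x, 0 <= f x) ->
  \int[P]_w f (sample Y n w) =
  \int[P]_w (f (sample xi n w) * (tilt n a (sample xi n w))%:E).
Proof.
move=> a0; elim: n xi Y f => [|n IH] xi Y f [ixi lxi] YE mf f0.
  apply: eq_integral => w _; rewrite /tilt /sum_of_squares big_ord0 mulr0 expR0.
  by rewrite expr0 invr1 mulr1 mule1 (tuple0 (sample Y 0 w)) (tuple0 (sample xi 0 w)).
have iY : mutually_independent P Y.
  by apply: (mutually_independent_comp P xi Y (fun=> *%R a)).
have iidS : iid P (fun k => xi k.+1) (normal_prob 0 1).
  by split; [exact: mutually_independent_shift|move=> k; exact: lxi].
pose f' (z : R * n.-tuple R) := f [tuple of z.1 :: z.2].
have mf' : measurable_fun setT f'.
  by apply: (measurableT_comp mf); exact: measurable_cons_pair.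
have f'0 z : 0 <= f' z by exact: f0.
pose g (z : R * n.-tuple R) := f' z * (tilt n a z.2)%:E.
have mg : measurable_fun setT g.
  apply: emeasurable_funM => //; apply/measurable_EFinP.
  by apply: (measurableT_comp (measurable_tilt n a)).
have g0 z : 0 <= g z by rewrite mule_ge0// lee_fin ltW// tilt_gt0.
transitivity (\int[P]_w f' (Y 0%N w, sample (fun k => Y k.+1) n w)).
  by apply: eq_integral => w _; rewrite sample_cons.
rewrite ge0_integral_head_sample//.
(* [G] is what remains, as a function of the head, once the tail has been tilted and integrated
   out. *)
pose G x := \int[P]_w g (x, sample (fun k => xi k.+1) n w).
have G0 x : 0 <= G x by apply: integral_ge0 => w _; exact: g0.
have mG : measurable_fun setT G.
  rewrite (_ : G = fubini_F (distribution P (sample (fun k => xi k.+1) n)) g).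
    exact: measurable_fun_fubini_tonelli_F.
  apply/funext => x; rewrite /fubini_F ge0_integral_distribution//.
  exact: measurableT_comp.
transitivity (\int[P]_w G (a * xi 0%N w)%R).
  apply: eq_integral => w _; rewrite -YE /G /g /=.
  rewrite (IH (fun k => xi k.+1) (fun k => Y k.+1) (fun t => f' (Y 0%N w, t)))//.
  - exact: measurableT_comp.
pose k x := (a^-1 * expR ((1 - a ^- 2) / 2 * x ^+ 2))%R.
have mk : measurable_fun setT (EFin \o k).
  apply/measurable_EFinP; apply: measurable_funM => //.
  by apply: measurableT_comp => //; exact: measurable_funM.
have k0 x : 0 <= (k x)%:E.
  by rewrite lee_fin mulr_ge0 ?expR_ge0// invr_ge0 ltW.
transitivity (\int[P]_w (G (xi 0%N w) * (k (xi 0%N w))%:E)).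
  rewrite (ge0_integral_normal_law P (xi 0%N) _ _ (fun x => G (a * x)%R) (lxi 0%N)).
  - rewrite ge0_integral_normal_prob_tilt//.
    rewrite (ge0_integral_normal_law P (xi 0%N) _ _ (fun x => G x * (k x)%:E) (lxi 0%N))//.
    + exact: emeasurable_funM.
    + by move=> x; rewrite mule_ge0.
  - by apply: (measurableT_comp mG); exact: measurable_funM.
  - by move=> x; exact: G0.
pose h (z : R * n.-tuple R) := g z * (k z.1)%:E.
have mh : measurable_fun setT h.
  by apply: emeasurable_funM => //; exact: (measurableT_comp mk).
have h0 z : 0 <= h z by rewrite mule_ge0.
transitivity (\int[P]_w h (xi 0%N w, sample (fun k => xi k.+1) n w)); last first.
  apply: eq_integral => w _; rewrite sample_cons tilt_cons /h /g /f' /=.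
  by rewrite -muleA -EFinM mulrC.
rewrite ge0_integral_head_sample//.
apply: eq_integral => w _; rewrite /h /= ge0_integralZr//.
by apply: (measurableT_comp mg); exact: measurable_fun_pair.
Qed.

End tilted_samples.

(** * Differentiation under the integral and Gaussian moments *)

Section difference_quotient.
Context {d : measure_display} {Omega : measurableType d} {R : realType}.
Variable P : probability Omega R.

(** Both bounds are 1 + z <= exp z, at z = c y for the lower one and z = - c y for the upper one.
    Together they squeeze the quotient as c tends to 0; the upper one dominates it uniformly in
    c. *)
Lemma expRN_quotient_bounds (c y : R) : 0 < c -> 0 <= y ->
  y / (1 + c * y) <= (1 - expR (- (c * y))) / c <= y.
Proof.
move=> c0 y0.
have cy1 : 0 < 1 + c * y by rewrite ltr_pwDl// mulr_ge0// ltW.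
apply/andP; split; last first.
  rewrite ler_pdivrMr// lerBlDr -lerBlDl mulrC.
  by have := expR_ge1Dx (- (c * y)).
rewrite ler_pdivlMr// lerBrDr -lerBrDl.
rewrite (_ : 1 - _ = (1 + c * y)^-1); last by field; rewrite gt_eqF.
by rewrite expRN lef_pV2 ?posrE ?expR_gt0//; exact: expR_ge1Dx.
Qed.

Lemma cvg_expRN_quotient (c : R^nat) (y : R) : (forall n, 0 < c n) ->
  c n @[n --> \oo] --> 0 -> 0 <= y ->
  (1 - expR (- (c n * y))) / c n @[n --> \oo] --> y.
Proof.
move=> c0 cc y0.
apply: (@squeeze_cvgr _ _ _ _ (fun n => y / (1 + c n * y)) (fun=> y)).
- by apply: nearW => n; exact: expRN_quotient_bounds.
- rewrite -[X in _ --> X](_ : y / (1 + 0 * y) = y); last first.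
    by rewrite mul0r addr0 divr1.
  apply: cvgM; first exact: cvg_cst.
  apply: cvgV; first by rewrite mul0r addr0 oner_neq0.
  by apply: cvgD; [exact: cvg_cst|apply: cvgM => //; exact: cvg_cst].
- exact: cvg_cst.
Qed.

(** The negative exponent keeps the quotient between 0 and [S], so dominated convergence applies
    with |F S| as bound. *)
Lemma cvg_Rintegral_expRN_quotient (F S : Omega -> R) (c : R^nat) :
  measurable_fun setT F -> measurable_fun setT S -> (forall w, 0 <= S w) ->
  P.-integrable setT (EFin \o (F \* S)) ->
  (forall n, 0 < c n) -> c n @[n --> \oo] --> 0 ->
  \int[P]_w (F w * ((1 - expR (- (c n * S w))) / c n)) @[n --> \oo] -->
  \int[P]_w (F w * S w).
Proof.
move=> mF mS S0 iFS c0 cc; apply: fine_cvg.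
rewrite fineK; last exact: integrable_fin_num.
apply: (@dominated_cvg _ _ _ _ _ measurableT _ _
  (fun w => `|(F w * S w)%:E|)%E).
- move=> n; apply/measurable_EFinP; apply: measurable_funM => //.
  apply: measurable_funM => //; apply: measurable_funB => //.
  apply: measurableT_comp => //; apply: measurableT_comp => //.
  exact: measurable_funM.
- move=> w _; apply: cvg_EFin; first exact: nearW.
  by apply: cvgM; [exact: cvg_cst|exact: cvg_expRN_quotient].
- by [].
- exact: integrable_abse.
- move=> n w _; rewrite !abse_EFin lee_fin !normrM.
  apply: ler_wpM2l => //; rewrite -normrM.
  have /andP[h1 h2] := expRN_quotient_bounds _ _ (c0 n) (S0 w).
  rewrite !ger0_norm//; apply: le_trans h1.
  by rewrite divr_ge0// addr_ge0// mulr_ge0// ltW.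
Qed.

(** From y^k <= k! exp y at y = c S, a single term of the exponential series. *)
Lemma integrable_power_expR (S : Omega -> R) (c : R) (k : nat) : 0 < c ->
  measurable_fun setT S -> (forall w, 0 <= S w) ->
  (\int[P]_w (expR (c * S w))%:E < +oo)%E ->
  P.-integrable setT (EFin \o (fun w => S w ^+ k)).
Proof.
move=> c0 mS S0 Soo; pose b : R := c ^- k * k`!%:R.
have b0 : 0 <= b by rewrite mulr_ge0// invr_ge0 exprn_ge0// ltW.
have mE : measurable_fun setT (fun w => (expR (c * S w))%:E).
  apply/measurable_EFinP; apply: measurableT_comp => //.
  exact: measurable_funM.
have iE : P.-integrable setT (fun w => (expR (c * S w))%:E).
  apply/integrableP; split=> //.
  by under eq_integral do rewrite abse_EFin ger0_norm ?expR_ge0//.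
apply: (le_integrable measurableT _ _ (integrableZl measurableT b iE)).
  by apply/measurable_EFinP; exact: measurable_funX.
move=> w _; rewrite -EFinM !abse_EFin lee_fin !ger0_norm ?exprn_ge0//; last first.
  by rewrite mulr_ge0// expR_ge0.
have y0 : 0 <= c * S w by rewrite mulr_ge0// ltW.
have -> : S w ^+ k = c ^- k * (c * S w) ^+ k.
  by rewrite exprMn mulKf// expf_neq0// gt_eqF.
rewrite /b -mulrA; apply: ler_wpM2l; first by rewrite invr_ge0 exprn_ge0// ltW.
rewrite [leRHS]mulrC -ler_pdivrMr ?ltr0n ?fact_gt0//.
(* [expR_ge1Dxn] handles the terms of degree at least 1; degree 0 is treated apart. *)
case: k {b b0} => [|k].
  by rewrite expr0 fact0 mulr1n divr1; apply: le_trans (expR_ge1Dx _); rewrite lerDl.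
by apply: le_trans (expR_ge1Dxn k y0); rewrite lerDr.
Qed.

End difference_quotient.

Section shrinking_scales.
Context {R : realType}.

(** Scales tending to 1 from below, so that the tilt has a negative exponent. *)
Definition shrink (n : nat) : R := n.+1%:R / n.+2%:R.

(** The exponent of [tilt] at scale [shrink n] with its sign changed; it is equivalent to 1 -
    [shrink n]. *)
Definition shrink_rate (n : nat) : R := (shrink n ^- 2 - 1) / 2.

Lemma shrink_gt0 n : 0 < shrink n.
Proof. by rewrite divr_gt0. Qed.

Lemma shrink_lt1 n : shrink n < 1.
Proof. by rewrite ltr_pdivrMr// mul1r ltr_nat. Qed.

Lemma cvg_shrink : shrink n @[n --> \oo] --> (1 : R).
Proof.
rewrite (_ : shrink = fun n => 1 - n.+2%:R^-1); last first.
  by apply/funext => n; rewrite /shrink; field.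
rewrite -[X in _ --> X]subr0; apply: cvgB; first exact: cvg_cst.
by rewrite (cvg_shiftS (@harmonic R)); exact: cvg_harmonic.
Qed.

Lemma shrink_rateE n : (1 - shrink n ^- 2) / 2 = - shrink_rate n.
Proof. by rewrite /shrink_rate -mulNr opprB. Qed.

Lemma shrink_rate_gt0 n : 0 < shrink_rate n.
Proof.
rewrite divr_gt0// subr_gt0 invf_gt1 ?exprn_gt0 ?shrink_gt0//.
by rewrite expr_lt1 ?shrink_lt1// ltW// shrink_gt0.
Qed.

Lemma cvg_shrink_rate : shrink_rate n @[n --> \oo] --> (0 : R).
Proof.
rewrite -[X in _ --> X](_ : (1 ^- 2 - 1) / 2 = 0 :> R); last first.
  by rewrite expr1n invr1 subrr mul0r.
apply: cvgM; last exact: cvg_cst.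
apply: cvgB; last exact: cvg_cst.
apply: cvgV; first by rewrite expr1n oner_neq0.
exact: (continuous_cvg _ (@exprn_continuous R 2 1) cvg_shrink).
Qed.

End shrinking_scales.

Section normal_moments.
Context {d : measure_display} {Omega : measurableType d} {R : realType}.
Variables (P : probability Omega R) (Z : {RV P >-> R}).
Hypothesis lZ : has_law P Z (normal_prob 0 1).
Local Open Scope ereal_scope.

Lemma ge0_expectation_normal_tilt (a : R) (f : R -> \bar R) :
  (0 < a)%R -> measurable_fun setT f -> (forall x, 0 <= f x) ->
  \int[P]_w (f (Z w) * (expR ((1 - a ^- 2) / 2 * Z w ^+ 2))%:E) =
  a%:E * \int[P]_w f (a * Z w)%R.
Proof.
move=> a0 mf f0; pose e (x : R) := expR ((1 - a ^- 2) / 2 * x ^+ 2).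
have me : measurable_fun setT (EFin \o e).
  apply/measurable_EFinP; apply: measurableT_comp => //.
  exact: measurable_funM.
have e0 x : 0 <= (e x)%:E by rewrite lee_fin expR_ge0.
have fe0 x : 0 <= f x * (e x)%:E by rewrite mule_ge0.
have mfe : measurable_fun setT (fun x => f x * (e x)%:E).
  exact: emeasurable_funM.
rewrite (ge0_integral_normal_law P Z _ _ (fun x => f (a * x)%R) lZ); last 2 first.
- by apply: (measurableT_comp mf); exact: measurable_funM.
- by move=> x; exact: f0.
rewrite (ge0_integral_normal_prob_tilt a f a0 mf f0).
rewrite (ge0_integral_normal_law P Z _ _ (fun x => f x * (e x)%:E) lZ mfe fe0).
under [in RHS]eq_integral do rewrite EFinM muleCA.
rewrite ge0_integralZl//; last by rewrite lee_fin invr_ge0 ltW.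
by rewrite muleA -EFinM mulfV ?mul1e// gt_eqF.
Qed.

Lemma integrable_normal_even_power (k : nat) :
  P.-integrable setT (EFin \o (fun w => Z w ^+ k.*2))%R.
Proof.
have mZ2 : measurable_fun setT (fun w => Z w ^+ 2)%R by exact: measurable_funX.
(* 1/4 is the tilt exponent (1 - a^-2) / 2 at a = sqrt 2, where the exponential moment equals sqrt
   2. *)
have c0 : (0 < 1 / 4 :> R)%R by rewrite divr_gt0.
have := integrable_power_expR P (fun w => Z w ^+ 2)%R _ k c0 mZ2.
rewrite (_ : (fun w => _ ^+ k)%R = fun w => Z w ^+ k.*2)%R; last first.
  by apply/funext => w; rewrite -exprM mul2n.
apply=> [w|]; first exact: sqr_ge0.
have := ge0_expectation_normal_tilt (Num.sqrt 2) (cst 1).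
rewrite sqr_sqrtr// (_ : (1 - 2^-1) / 2 = 1 / 4 :> R)%R; last by field.
under eq_integral do rewrite mul1e.
have s0 : (0 < Num.sqrt (2 : R))%R by rewrite sqrtr_gt0.
move=> /(_ s0 (measurable_cst _) (fun=> lee01)) ->.
by rewrite integral_cst//= probability_setT mul1e mule1 ltry.
Qed.

Local Close Scope ereal_scope.

(** Tilting gives E (Z^(2k) exp(- c Z^2)) = a^(2k+1) E Z^(2k), and 1 - a^(2k+1) is equivalent to
    (2k+1) c as a tends to 1. This stands in for an integration by parts. *)
Lemma normal_moment_rec (k : nat) :
  \int[P]_w (Z w ^+ k.+1.*2) = k.*2.+1%:R * \int[P]_w (Z w ^+ k.*2).
Proof.
pose a := @shrink R; pose c := @shrink_rate R.
have a0 := @shrink_gt0 R; have a1 := @shrink_lt1 R; have ca := @cvg_shrink R.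
have c0 := @shrink_rate_gt0 R; have cc := @cvg_shrink_rate R.
have caX i : a n ^+ i @[n --> \oo] --> (1 ^+ i : R).
  exact: (continuous_cvg _ (@exprn_continuous R i 1) ca).
have mZ2 : measurable_fun setT (fun w => Z w ^+ 2) by exact: measurable_funX.
have mZk : measurable_fun setT (fun w => Z w ^+ k.*2) by exact: measurable_funX.
have iS : P.-integrable setT (EFin \o ((fun w => Z w ^+ k.*2) \* (fun w => Z w ^+ 2))).
  rewrite (_ : _ \* _ = fun w => Z w ^+ k.+1.*2).
    exact: integrable_normal_even_power.
  by apply/funext => w /=; rewrite -exprD doubleS addn2.
have := cvg_Rintegral_expRN_quotient P _ _ c mZk mZ2 (fun w => sqr_ge0 _) iS c0 cc.
rewrite (_ : \int[P]_w (Z w ^+ k.*2 * Z w ^+ 2) = \int[P]_w (Z w ^+ k.+1.*2)); last first.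
  by apply: eq_Rintegral => w _; rewrite -exprD doubleS addn2.
move=> cvgE.
set m := \int[P]_w (Z w ^+ k.*2).
have an := @shrink_rateE R.
have expE n : \int[P]_w (Z w ^+ k.*2 * expR (- (c n * Z w ^+ 2))) =
    a n ^+ k.*2.+1 * m.
  have mX : measurable_fun setT (fun x : R => (x ^+ k.*2)%:E).
    by apply/measurable_EFinP; exact: measurable_funX.
  have X0 (x : R) : (0 <= (x ^+ k.*2)%:E)%E.
    by rewrite lee_fin -muln2 exprM sqr_ge0.
  rewrite {1}/Rintegral.
  have E := ge0_expectation_normal_tilt (a n) _ (a0 n) mX X0; rewrite an in E.
  under eq_integral do rewrite -mulNr EFinM.
  rewrite E; under eq_integral do rewrite exprMn EFinM.
  have i2k := integrable_normal_even_power k.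
  rewrite integralZl// -(fineK (integrable_fin_num _ i2k))//= -/(Rintegral _ _ _).
  by rewrite mulrA -exprS.
(* Both 1 - a^(2k+1) and c = (1 - a) (1 + a) / (2 a^2) contain the factor 1 - a; cancelling it
   leaves a function continuous at a = 1. *)
have quotE n : \int[P]_w (Z w ^+ k.*2 * ((1 - expR (- (c n * Z w ^+ 2))) / c n)) =
    2 * a n ^+ 2 * (\sum_(i < k.*2.+1) a n ^+ i) / (1 + a n) * m.
  have i2k := integrable_normal_even_power k.
  have iE : P.-integrable setT
      (EFin \o (fun w => Z w ^+ k.*2 * expR (- (c n * Z w ^+ 2)))).
    apply: le_integrable i2k => //.
      apply/measurable_EFinP; apply: measurable_funM.
        exact: measurable_funX.
      apply: measurableT_comp => //; apply: measurableT_comp => //.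
      exact: measurable_funM.
    move=> w _; rewrite !abse_EFin lee_fin normrM ler_piMr//.
    rewrite ger0_norm ?expR_ge0// -expR0 ler_expR oppr_le0.
    by rewrite mulr_ge0 ?sqr_ge0// ltW.
  transitivity (\int[P]_w
      ((Z w ^+ k.*2 - Z w ^+ k.*2 * expR (- (c n * Z w ^+ 2))) * (c n)^-1)).
    by apply: eq_Rintegral => w _; ring.
  rewrite RintegralZr//; last exact: (integrableB measurableT i2k iE).
  rewrite RintegralB// expE -/m.
  transitivity ((1 - a n) * (\sum_(i < k.*2.+1) a n ^+ i) * m / c n).
    by rewrite -[(1 - a n)]opprB mulNr -subrX1 opprB; congr (_ / _); ring.
  rewrite /c /shrink_rate -/(a n); field.
  apply/and3P; split; [by rewrite gt_eqF ?addr_gt0|by rewrite gt_eqF|].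
  by rewrite mulN1r subr_eq0 eq_sym lt_eqF// expr_lt1// ltW.
rewrite -(cvg_lim (@Rhausdorff R) cvgE).
apply: (cvg_lim (@Rhausdorff R)); rewrite (funext quotE).
rewrite (_ : _ * m = 2 * 1 ^+ 2 * (\sum_(i < k.*2.+1) 1 ^+ i) / (1 + 1) * m).
  apply: cvgM; last exact: cvg_cst.
  apply: cvgM; last first.
    apply: cvgV; first by rewrite -mulr2n pnatr_eq0.
    by apply: cvgD => //; exact: cvg_cst.
  apply: cvgM.
    apply: cvgM; first exact: cvg_cst.
    exact: caX.
  apply: cvg_big => [|i _]; first by move=> z; exact: add_continuous.
  exact: caX.
under eq_bigr do rewrite expr1n.
rewrite sumr_const card_ord; by congr (_ * _); field.
Qed.

End normal_moments.

Section rescaled_samples.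
Context {d : measure_display} {Omega : measurableType d} {R : realType}.
Variables (P : probability Omega R) (xi : nat -> {RV P >-> R}).
Hypothesis xi_iid : iid P xi (normal_prob 0 1).
Local Open Scope ereal_scope.

Lemma expectation_expR_sum_of_squares (n : nat) (a : R) : (0 < a)%R ->
  \int[P]_w (expR ((1 - a ^- 2) / 2 * sum_of_squares n (sample xi n w)))%:E =
  (a ^+ n)%:E.
Proof.
move=> a0.
pose Y k : {RV P >-> R} := (cst a \* xi k)%R.
have := ge0_integral_sample_tilt P n a xi Y (cst 1) a0 xi_iid (fun _ _ => erefl)
  (measurable_cst _) (fun=> lee01).
rewrite integral_cst//= probability_setT mule1.
under eq_integral do rewrite mul1e EFinM.
rewrite ge0_integralZl//.
- move=> /(congr1 (fun y => (a ^+ n)%:E * y)); rewrite mule1 muleA -EFinM.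
  by rewrite mulfV ?mul1e// expf_neq0// gt_eqF.
- apply/measurable_EFinP; apply: measurableT_comp => //.
  apply: measurable_funM => //.
  exact: (measurableT_comp (measurable_sum_of_squares n)).
- by rewrite lee_fin invr_ge0 exprn_ge0// ltW.
Qed.

Variable X : R -> nat -> {RV P >-> R}.
Hypothesis XE : forall s k w, X s k w = (s * xi k w)%R.

Lemma ge0_integral_rescale (n : nat) (s a : R) (f : n.-tuple R -> \bar R) :
  (0 < a)%R ->
  measurable_fun setT f -> (forall x, 0 <= f x) ->
  \int[P]_w f (sample (X (s * a)) n w) =
  \int[P]_w (f (sample (X s) n w) * (tilt n a (sample xi n w))%:E).
Proof.
move=> a0 mf f0.
pose g (x : n.-tuple R) : n.-tuple R := [tuple s * tnth x i | i < n]%R.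
have mg : measurable_fun setT g.
  apply/measurable_fun_tnthP => i.
  rewrite (_ : _ \o g = fun x => s * tnth x i)%R; last first.
    by apply/funext => x /=; rewrite tnth_mktuple.
  by apply: measurable_funM => //; exact: measurable_tnth.
have gE a' w : sample (X (s * a')) n w = g (sample (X a') n w).
  by apply: eq_from_tnth => i; rewrite !tnth_mktuple !XE mulrA.
have gE1 w : sample (X s) n w = g (sample xi n w).
  by apply: eq_from_tnth => i; rewrite !tnth_mktuple !XE.
under eq_integral do rewrite gE.
under [RHS]eq_integral do rewrite gE1.
apply: (ge0_integral_sample_tilt P n a xi (X a) (f \o g)) => //.
- exact: measurableT_comp.
- by move=> x; exact: f0.
Qed.

Local Close Scope ereal_scope.

Lemma measurable_fun_sample (n : nat) (s : R) (f : n.-tuple R -> R) :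
  measurable_fun setT f -> measurable_fun setT (fun w => f (sample (X s) n w)).
Proof. by move=> mf; exact: (measurableT_comp mf). Qed.

(** Multiplication by the positive tilt commutes with taking positive and negative parts, so the
    nonnegative case applies to each. *)
Lemma integral_rescale (n : nat) (s a : R) (f : n.-tuple R -> R) :
  0 < a -> measurable_fun setT f ->
  (\int[P]_w (f (sample (X (s * a)) n w))%:E =
  \int[P]_w (f (sample (X s) n w) * tilt n a (sample xi n w))%:E)%E.
Proof.
move=> a0 mf; rewrite [LHS]integralE [RHS]integralE.
have mEf : measurable_fun setT (EFin \o f) by exact/measurable_EFinP.
congr (_ - _)%E.
- transitivity (\int[P]_w (EFin \o f)^\+%E (sample (X (s * a)) n w))%E.
    by apply: eq_integral => w _; rewrite !funeposE.
  rewrite ge0_integral_rescale//; last exact: measurable_funepos.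
  apply: eq_integral => w _; rewrite !funeposE [(_ * tilt _ _ _)%R]mulrC EFinM.
  by rewrite muleC maxe_pMr ?mule0// lee_fin ltW// tilt_gt0.
- transitivity (\int[P]_w (EFin \o f)^\-%E (sample (X (s * a)) n w))%E.
    by apply: eq_integral => w _; rewrite !funenegE.
  rewrite ge0_integral_rescale//; last exact: measurable_funeneg.
  apply: eq_integral => w _; rewrite !funenegE [(_ * tilt _ _ _)%R]mulrC EFinM.
  by rewrite muleC maxe_pMr ?mule0 ?muleN// lee_fin ltW// tilt_gt0.
Qed.

(* Differentiating [E f(s a xi) = 0] in [a] at [a = 1]. *)
Lemma Rintegral_sum_of_squares_eq0 (n : nat) (s : R) (f : n.-tuple R -> R) :
  0 < s -> measurable_fun setT f ->
  (forall s', 0 < s' -> (\int[P]_w (f (sample (X s') n w))%:E = 0)%E) ->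
  P.-integrable setT (fun w => (f (sample (X s) n w))%:E) ->
  P.-integrable setT (fun w =>
    (f (sample (X s) n w) * sum_of_squares n (sample (X s) n w))%:E) ->
  \int[P]_w (f (sample (X s) n w) * sum_of_squares n (sample (X s) n w)) = 0.
Proof.
move=> s0 mf f0 iF iFS.
pose F w := f (sample (X s) n w); pose S w := sum_of_squares n (sample xi n w).
have SE w : sum_of_squares n (sample (X s) n w) = s ^+ 2 * S w.
  rewrite /S /sum_of_squares mulr_sumr; apply: eq_bigr => i _.
  by rewrite !tnth_mktuple XE exprMn.
have mF : measurable_fun setT F by exact: measurable_fun_sample.
have mS : measurable_fun setT S.
  exact: (measurableT_comp (measurable_sum_of_squares n)).
have S0 w : 0 <= S w by exact: sum_of_squares_ge0.
have iFS' : P.-integrable setT (EFin \o (F \* S)).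
  have := integrableZl measurableT (s ^- 2) iFS; apply: eq_integrable => // w _.
  by rewrite -EFinM /= SE -/(F w); congr EFin; field; rewrite gt_eqF.
suff FS0 : \int[P]_w (F w * S w) = 0.
  transitivity (\int[P]_w (s ^+ 2 * (F w * S w))).
    by apply: eq_Rintegral => w _; rewrite SE mulrCA.
  by rewrite RintegralZl// FS0 mulr0.
have a0 := @shrink_gt0 R.
have cvgE := cvg_Rintegral_expRN_quotient P F S (@shrink_rate R) mF mS S0 iFS'
  (@shrink_rate_gt0 R) (@cvg_shrink_rate R).
rewrite -(cvg_lim (@Rhausdorff R) cvgE).
(* The difference quotients vanish identically, as F and F exp(- c S) both have integral zero. *)
rewrite (_ : (fun _ => _) = fun=> 0); first exact: lim_cst.
apply/funext => m; set c := shrink_rate m; pose a : R := shrink m.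
have c0 : 0 < c by exact: shrink_rate_gt0.
have iE : P.-integrable setT (EFin \o (fun w => F w * expR (- (c * S w)))).
  apply: le_integrable iF => //.
    apply/measurable_EFinP; apply: measurable_funM => //.
    apply: measurableT_comp => //; apply: measurableT_comp => //.
    exact: measurable_funM.
  move=> w _; rewrite !abse_EFin lee_fin normrM ler_piMr//.
  rewrite ger0_norm ?expR_ge0// -expR0 ler_expR oppr_le0.
  by rewrite mulr_ge0// ltW.
have FE0 : \int[P]_w (F w * expR (- (c * S w))) = 0.
  (* At scale [s * a] the vanishing mean is [a ^- n] times the integral sought, and [a ^- n] is
     nonzero. *)
  have := f0 (s * a) (mulr_gt0 s0 (a0 m)).
  rewrite (integral_rescale _ _ _ _ (a0 m) mf).
  under eq_integral do rewrite /tilt shrink_rateE mulNr mulrCA EFinM.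
  rewrite integralZl// => /eqP; rewrite mule_eq0 => /orP[|/eqP E].
    by rewrite eqe invr_eq0 expf_eq0 gt_eqF ?andbF// a0.
  by rewrite /Rintegral; rewrite -[RHS]/(fine 0); congr fine.
transitivity (\int[P]_w ((F w - F w * expR (- (c * S w))) * c^-1)).
  by apply: eq_Rintegral => w _; ring.
rewrite RintegralZr//; last exact: (integrableB measurableT iF iE).
by rewrite RintegralB// FE0 /Rintegral f0//= subrr mul0r.
Qed.

End rescaled_samples.

(** * Unbiased estimation *)

Section variance_decomposition.
Context {d : measure_display} {S : measurableType d} {R : realType}.
Variable Q : probability S R.

Lemma integrable_mul_of_sqr (F G : S -> R) :
  measurable_fun setT F -> measurable_fun setT G ->
  Q.-integrable setT (EFin \o (fun x => F x ^+ 2)) ->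
  Q.-integrable setT (EFin \o (fun x => G x ^+ 2)) ->
  Q.-integrable setT (EFin \o (fun x => F x * G x)).
Proof.
move=> mF mG iF iG; apply: (le_integrable measurableT _ _ (integrableD measurableT iF iG)).
  by apply/measurable_EFinP; exact: measurable_funM.
move=> x _; rewrite /= lee_fin [leRHS]ger0_norm ?addr_ge0 ?sqr_ge0//.
have := sqr_ge0 (F x - G x); have := sqr_ge0 (F x + G x).
by rewrite ler_norml => h1 h2; apply/andP; split; nra.
Qed.

Lemma integrable_sqrB (F G : S -> R) :
  measurable_fun setT F -> measurable_fun setT G ->
  Q.-integrable setT (EFin \o (fun x => F x ^+ 2)) ->
  Q.-integrable setT (EFin \o (fun x => G x ^+ 2)) ->
  Q.-integrable setT (EFin \o (fun x => (F x - G x) ^+ 2)).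
Proof.
move=> mF mG iF iG.
have i2 := integrableZl measurableT 2 (integrableD measurableT iF iG).
apply: (le_integrable measurableT _ _ i2).
  by apply/measurable_EFinP; apply: measurable_funX; exact: measurable_funB.
move=> x _; rewrite /= lee_fin !ger0_norm ?sqr_ge0 ?mulr_ge0 ?addr_ge0 ?sqr_ge0//.
by have := sqr_ge0 (F x + G x); nra.
Qed.

Lemma ge0_integrable (F : S -> R) : measurable_fun setT F ->
  (forall x, 0 <= F x) -> (\int[Q]_x (F x)%:E < +oo)%E ->
  Q.-integrable setT (EFin \o F).
Proof.
move=> mF F0 Foo; apply/integrableP; split; first exact/measurable_EFinP.
by under eq_integral do rewrite /= ger0_norm//.
Qed.

(** Pythagoras in L^2 for F = G + (F - G); square-integrability lets the cross term be split off. *)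
Lemma integral_sqr_orthogonal (F G : S -> R) :
  measurable_fun setT F -> measurable_fun setT G ->
  Q.-integrable setT (EFin \o (fun x => F x ^+ 2)) ->
  Q.-integrable setT (EFin \o (fun x => G x ^+ 2)) ->
  \int[Q]_x ((F x - G x) * G x) = 0 ->
  (\int[Q]_x (F x ^+ 2)%:E =
   \int[Q]_x (G x ^+ 2)%:E + \int[Q]_x ((F x - G x) ^+ 2)%:E)%E.
Proof.
move=> mF mG iF iG FG0.
have mB : measurable_fun setT (fun x => F x - G x) by exact: measurable_funB.
have iB := integrable_sqrB F G mF mG iF iG.
have iBG := integrable_mul_of_sqr _ _ mB mG iB iG.
have E0 : (\int[Q]_x ((F x - G x) * G x)%:E = 0)%E.
  by rewrite -(fineK (integrable_fin_num measurableT iBG)); congr EFin.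
transitivity (\int[Q]_x ((G x ^+ 2)%:E + ((F x - G x) ^+ 2)%:E +
    2%:E * ((F x - G x) * G x)%:E))%E.
  by apply: eq_integral => x _; rewrite -!EFinM -!EFinD; congr EFin; ring.
rewrite integralD//=; last 2 first.
- exact: (integrableD measurableT iG iB).
- exact: (integrableZl measurableT 2 iBG).
rewrite integralZl// E0 mule0 adde0 integralD//.
Qed.

Lemma variance_of_mean (T : S -> R) (v : R) : ('E_Q[T] = v%:E)%E ->
  ('V_Q[T] = \int[Q]_x ((T x - v) ^+ 2)%:E)%E.
Proof.
move=> ET; rewrite /variance unlock ET /= unlock.
by apply: eq_integral => x _; rewrite expr2.
Qed.

End variance_decomposition.

Section distribution_transfer.
Context {d d' : measure_display} {Omega : measurableType d}.
Context {S : measurableType d'} {R : realType}.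
Variables (P : probability Omega R) (Y : {mfun Omega >-> S}).

Lemma integrable_distribution (f : S -> R) : measurable_fun setT f ->
  (distribution P Y).-integrable setT (EFin \o f) <->
  P.-integrable setT (fun w => (f (Y w))%:E).
Proof.
move=> mf; have mEf : measurable_fun setT (EFin \o f) by exact/measurable_EFinP.
split=> /integrableP[_ h]; apply/integrableP; split => //.
- by apply: (measurableT_comp mEf).
- move: h; rewrite ge0_integral_distribution//.
  exact: measurableT_comp.
- rewrite ge0_integral_distribution//.
  exact: measurableT_comp.
Qed.

Lemma integral_distribution_real (f : S -> R) : measurable_fun setT f ->
  (\int[distribution P Y]_x (f x)%:E = \int[P]_w (f (Y w))%:E)%E.
Proof.
move=> mf; have mEf : measurable_fun setT (EFin \o f) by exact/measurable_EFinP.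
rewrite integralE [RHS]integralE; congr (_ - _)%E.
- rewrite ge0_integral_distribution//; last exact: measurable_funepos.
  by apply: eq_integral => w _ /=; rewrite !funeposE.
- rewrite ge0_integral_distribution//; last exact: measurable_funeneg.
  by apply: eq_integral => w _ /=; rewrite !funenegE.
Qed.

End distribution_transfer.

Section minimal_variance.
Context {d : measure_display} {Omega : measurableType d} {R : realType}.
Variables (P : probability Omega R) (xi : nat -> {RV P >-> R}).
Hypothesis xi_iid : iid P xi (normal_prob 0 1).
Variable X : R -> nat -> {RV P >-> R}.
Hypothesis XE : forall s k w, X s k w = s * xi k w.

(** The parameter is the variance, whereas [X] is indexed by the standard deviation. *)
Let Q (n : nat) (v : R) : probability (n.-tuple R) R :=
  distribution P (sample (X (Num.sqrt v)) n).

Let Theta : set R := [set v | 0 < v].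

Lemma sum_of_squares_sample (n : nat) (s : R) (w : Omega) :
  sum_of_squares n (sample (X s) n w) = s ^+ 2 * \sum_(i < n) xi i w ^+ 2.
Proof.
rewrite /sum_of_squares mulr_sumr; apply: eq_bigr => i _.
by rewrite tnth_mktuple XE exprMn.
Qed.

(** The exponential moment at a = sqrt 2 dominates every power. Thus the estimator lies in L^2, and
    its products with square-integrable functions are integrable. *)
Lemma integrable_sum_of_squares_power (n k : nat) (s : R) :
  P.-integrable setT
    (EFin \o (fun w => sum_of_squares n (sample (X s) n w) ^+ k)).
Proof.
pose S w := sum_of_squares n (sample xi n w).
have SE w : sum_of_squares n (sample (X s) n w) ^+ k = (s ^+ 2) ^+ k * S w ^+ k.
  rewrite -exprMn sum_of_squares_sample; congr ((_ * _) ^+ _).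
  by apply: eq_bigr => i _; rewrite tnth_mktuple.
have mS : measurable_fun setT S.
  exact: (measurableT_comp (measurable_sum_of_squares n)).
have c0 : 0 < 1 / 4 :> R by rewrite divr_gt0.
have s0 : 0 < Num.sqrt 2 :> R by rewrite sqrtr_gt0.
have := integrable_power_expR P S _ k c0 mS (fun w => sum_of_squares_ge0 _ _).
have := expectation_expR_sum_of_squares P xi xi_iid n _ s0.
rewrite sqr_sqrtr// (_ : (1 - 2^-1) / 2 = 1 / 4 :> R); last by field.
move=> -> /(_ (ltry _)) /(integrableZl measurableT ((s ^+ 2) ^+ k)).
by apply: eq_integrable => // w _; rewrite /= SE EFinM.
Qed.

Lemma expectation_sum_of_squares (n : nat) (s : R) :
  (\int[P]_w (sum_of_squares n (sample (X s) n w))%:E = (n%:R * s ^+ 2)%:E)%E.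
Proof.
have ixi i : P.-integrable setT (EFin \o (fun w => xi i w ^+ 2)).
  exact: (integrable_normal_even_power P _ (xi_iid.2 i) 1).
have m2 i : (\int[P]_w (xi i w ^+ 2)%:E = 1)%E.
  rewrite -(fineK (integrable_fin_num measurableT (ixi i))).
  have := normal_moment_rec P _ (xi_iid.2 i) 0.
  rewrite /= /Rintegral => ->.
  under eq_integral do rewrite expr0.
  by rewrite integral_cst//= probability_setT mule1 mulr1.
under eq_integral do rewrite sum_of_squares_sample mulr_sumr -sumEFin.
rewrite integral_sum//.
  rewrite (eq_bigr (fun=> (s ^+ 2)%:E)) => [|i _].
    by rewrite sumEFin sumr_const card_ord mulr_natl.
  under eq_integral do rewrite EFinM.
  rewrite integralZl//; last exact: ixi.
  by rewrite m2 mule1.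
move=> i; have := integrableZl measurableT (s ^+ 2) (ixi i).
by apply: eq_integrable => // w _; rewrite EFinM.
Qed.

Lemma variance_estimatorE (n : nat) (x : n.-tuple R) :
  variance_estimator x = n%:R^-1 * sum_of_squares n x.
Proof. by []. Qed.

Lemma unbiased_variance_estimator (n : nat) : (0 < n)%N ->
  unbiased Theta (Q n) (@variance_estimator R n).
Proof.
move=> n0 v v0; have mT := @measurable_variance_estimator R n.
have iS : P.-integrable setT
    (fun w => (variance_estimator (sample (X (Num.sqrt v)) n w))%:E).
  have := integrable_sum_of_squares_power n 1 (Num.sqrt v).
  move=> /(integrableZl measurableT n%:R^-1).
  by apply: eq_integrable => // w _; rewrite /= expr1.
split; first exact/integrable_distribution.
rewrite unlock integral_distribution_real//.
under eq_integral do rewrite variance_estimatorE EFinM.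
have := integrable_sum_of_squares_power n 1 (Num.sqrt v).
rewrite (_ : (fun w => _ ^+ 1) = fun w => sum_of_squares n (sample (X (Num.sqrt v)) n w))//.
move=> iS1; rewrite integralZl// expectation_sum_of_squares -EFinM sqr_sqrtr ?ltW//.
by rewrite mulKf// pnatr_eq0 -lt0n.
Qed.

Lemma integrable_sqr_variance_estimator_error (n : nat) (v : R) :
  (Q n v).-integrable setT
    (EFin \o (fun x => (variance_estimator x - v) ^+ 2)).
Proof.
have mT := @measurable_variance_estimator R n.
apply: integrable_sqrB => //.
- apply/integrable_distribution; first exact: measurable_funX.
  have := integrable_sum_of_squares_power n 2 (Num.sqrt v).
  move=> /(integrableZl measurableT (n%:R^-1 ^+ 2)).
  by apply: eq_integrable => // w _; rewrite /= variance_estimatorE exprMn.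
- exact: finite_measure_integrable_cst.
Qed.

(** The difference of the two estimators has mean zero at every parameter, hence is orthogonal to
    |X|^2 by differentiation in the dilation factor, hence to [variance_estimator x - v], which is
    affine in |X|^2. The finite second moment of [T] makes the product with |X|^2 integrable. *)
Lemma unbiased_orthogonal (n : nat) (T : n.-tuple R -> R) (v : R) :
  (0 < n)%N -> 0 < v -> measurable_fun setT T -> unbiased Theta (Q n) T ->
  (Q n v).-integrable setT (EFin \o (fun x => (T x - v) ^+ 2)) ->
  \int[Q n v]_x (((T x - v) - (variance_estimator x - v)) *
                 (variance_estimator x - v)) = 0.
Proof.
move=> n0 v0 mT uT iT; have mV := @measurable_variance_estimator R n.
have iV := integrable_sqr_variance_estimator_error n v.
have uV := unbiased_variance_estimator n n0.
pose D x := T x - variance_estimator x.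
have mD : measurable_fun setT D by exact: measurable_funB.
have iD v' : 0 < v' -> (Q n v').-integrable setT (EFin \o D).
  move=> v'0; have [iT' _] := uT _ v'0; have [iV' _] := uV _ v'0.
  exact: (integrableB measurableT iT' iV').
have ED v' : 0 < v' -> (\int[Q n v']_x (D x)%:E = 0)%E.
  move=> v'0; have [iT' ET] := uT _ v'0; have [iV' EV] := uV _ v'0.
  move: ET EV; rewrite unlock => ET EV.
  under eq_integral do rewrite EFinB.
  by rewrite integralB_EFin// ET EV subee.
have mTv : measurable_fun setT (fun x => T x - v) by exact: measurable_funB.
have mVv : measurable_fun setT (fun x : n.-tuple R => variance_estimator x - v).
  exact: measurable_funB.
have iD2 : (Q n v).-integrable setT (EFin \o (fun x => D x ^+ 2)).
  have := integrable_sqrB _ _ _ mTv mVv iT iV.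
  by apply: eq_integrable => // x _; rewrite /= /D; congr (_ ^+ 2)%:E; ring.
have mS := @measurable_sum_of_squares R n.
have iDS : (Q n v).-integrable setT (EFin \o (fun x => D x * sum_of_squares n x)).
  apply: integrable_mul_of_sqr => //; apply/integrable_distribution.
    exact: measurable_funX.
  exact: integrable_sum_of_squares_power.
have DS0 : (\int[Q n v]_x (D x * sum_of_squares n x)%:E = 0)%E.
  rewrite -(fineK (integrable_fin_num measurableT iDS)); congr EFin.
  rewrite integral_distribution_real; last exact: measurable_funM.
  apply: (Rintegral_sum_of_squares_eq0 P xi xi_iid X XE n _ D _ mD).
  - by rewrite sqrtr_gt0.
  (* Scale s' is the parameter s'^2: unbiasedness over the whole model is what gives vanishing at
     all scales. *)
  - move=> s' s'0; have v'0 : 0 < s' ^+ 2 by rewrite exprn_gt0.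
    have := ED _ v'0; rewrite integral_distribution_real//.
    by rewrite sqrtr_sqr gtr0_norm.
  - exact: ((integrable_distribution P (sample (X (Num.sqrt v)) n) D mD).1 (iD v v0)).
  - exact: ((integrable_distribution P (sample (X (Num.sqrt v)) n)
      (fun x => D x * sum_of_squares n x) (measurable_funM mD mS)).1 iDS).
rewrite /Rintegral.
transitivity (fine (\int[Q n v]_x
    (n%:R^-1%:E * (D x * sum_of_squares n x)%:E - v%:E * (D x)%:E)))%E.
  congr fine; apply: eq_integral => x _; rewrite -!EFinM -EFinB; congr EFin.
  by rewrite /D variance_estimatorE; ring.
rewrite integralB//; last 2 first.
- exact: integrableZl.
- by apply: integrableZl => //; exact: iD.
by rewrite integralZl// DS0 integralZl ?ED ?mule0 ?subee//; exact: iD.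
Qed.

Lemma variance_estimator_mvue (n : nat) : (0 < n)%N ->
  is_the_mvue Theta (Q n) (@variance_estimator R n).
Proof.
move=> n0; have mV := @measurable_variance_estimator R n.
have uV := unbiased_variance_estimator n n0.
have mVv v : measurable_fun setT (fun x : n.-tuple R => variance_estimator x - v).
  exact: measurable_funB.
have varE T v : unbiased Theta (Q n) T -> 0 < v ->
    ('V_(Q n v)[T] = \int[Q n v]_x ((T x - v) ^+ 2)%:E)%E.
  by move=> uT v0; apply: variance_of_mean; have [] := uT v v0.
(* The excess variance settles both claims: it is nonnegative, and it must vanish for any other
   minimizer. *)
have gap T v : measurable_fun setT T -> unbiased Theta (Q n) T -> 0 < v ->
    ('V_(Q n v)[T] < +oo)%E ->
    ('V_(Q n v)[T] = 'V_(Q n v)[@variance_estimator R n] +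
      \int[Q n v]_x ((T x - variance_estimator x) ^+ 2)%:E)%E.
  move=> mT uT v0; rewrite !varE// => Too.
  have mTv : measurable_fun setT (fun x => T x - v) by exact: measurable_funB.
  have iT : (Q n v).-integrable setT (EFin \o (fun x => (T x - v) ^+ 2)).
    apply: ge0_integrable => //; first exact: measurable_funX.
    by move=> x; exact: sqr_ge0.
  rewrite (integral_sqr_orthogonal (Q n v) _ _ mTv (mVv v) iT); last 2 first.
  - exact: integrable_sqr_variance_estimator_error.
  - exact: unbiased_orthogonal.
  by congr (_ + _)%E; apply: eq_integral => x _; congr (_ ^+ 2)%:E; ring.
(* Finiteness permits cancelling this variance in the extended reals when uniqueness is read off
   from [gap]. *)
have Voo v : 0 < v -> ('V_(Q n v)[@variance_estimator R n] \is a fin_num)%E.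
  move=> v0; rewrite varE//; apply: integrable_fin_num => //.
  exact: integrable_sqr_variance_estimator_error.
split; first split => //.
  move=> T mT uT v v0; have [Too|] := ltP 'V_(Q n v)[T]%E +oo%E; last first.
    by rewrite leye_eq => /eqP ->; rewrite leey.
  rewrite (gap T v)// leeDl//; apply: integral_ge0 => x _.
  by rewrite lee_fin sqr_ge0.
move=> T [mT uT minT] v v0.
have TV : ('V_(Q n v)[T] <= 'V_(Q n v)[@variance_estimator R n])%E.
  exact: minT.
have Too : ('V_(Q n v)[T] < +oo)%E.
  by apply: (le_lt_trans TV); rewrite ltey_eq Voo.
have mD : measurable_fun setT (fun x : n.-tuple R => T x - variance_estimator x).
  exact: measurable_funB.
have D0 : (\int[Q n v]_x ((T x - variance_estimator x) ^+ 2)%:E = 0)%E.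
  apply/eqP; rewrite eq_le integral_ge0 ?andbT; last first.
    by move=> x _; rewrite lee_fin sqr_ge0.
  move: TV; rewrite (gap T v)// => TV.
  by rewrite -(leeD2lE _ _ (Voo v v0)) adde0.
have : ae_eq (Q n v) setT (fun x => ((T x - variance_estimator x) ^+ 2)%:E) (cst 0%E).
  apply/ae_eq_integral_abs => //.
    by apply/measurable_EFinP; exact: measurable_funX.
  under eq_integral do rewrite abse_EFin ger0_norm ?sqr_ge0//.
  exact: D0.
apply: filterS => x /(_ I) [] /eqP.
by rewrite sqrf_eq0 subr_eq0 => /eqP.
Qed.

End minimal_variance.

(** * Maximum likelihood *)

Section maximum_likelihood.
Context {R : realType}.

Lemma normal_pdf_sqrt (v x : R) : 0 < v ->
  normal_pdf 0 (Num.sqrt v) x =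
  (Num.sqrt (2 * pi * v))^-1 * expR (- (x ^+ 2 / (2 * v))).
Proof.
move=> v0; rewrite normal_pdfE ?gt_eqF ?sqrtr_gt0//.
rewrite /normal_peak /normal_fun sqr_sqrtr ?ltW// subr0.
rewrite (_ : v * pi *+ 2 = 2 * pi * v); last by ring.
by congr (_ * expR _); rewrite -mulr_natr mulNr [v * _]mulrC.
Qed.

(** An n-th power of a one-observation profile: comparing likelihoods becomes comparing profiles. *)
Lemma iid_likelihood_normal (n : nat) (v : R) (x : n.-tuple R) :
  (0 < n)%N -> 0 < v ->
  iid_likelihood (fun v => normal_pdf 0 (Num.sqrt v)) v x =
  ((Num.sqrt (2 * pi * v))^-1 * expR (- (variance_estimator x / (2 * v)))) ^+ n.
Proof.
move=> n0 v0; rewrite /iid_likelihood.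
under eq_bigr do rewrite normal_pdf_sqrt//.
rewrite big_split/= prodr_const card_ord -expR_sum exprMn; congr (_ * _).
rewrite -expRM_natl; congr expR.
rewrite sumrN mulrN -mulr_suml; congr (- _).
rewrite /variance_estimator !mulrA mulfV ?mul1r//.
by rewrite pnatr_eq0 -lt0n.
Qed.

Lemma gaussian_profile_lt (u v : R) : 0 < u -> 0 < v -> v != u ->
  (Num.sqrt (2 * pi * v))^-1 * expR (- (u / (2 * v))) <
  (Num.sqrt (2 * pi * u))^-1 * expR (- (u / (2 * u))).
Proof.
move=> u0 v0 vu.
have pi2 : 0 < 2 * pi :> R by rewrite mulr_gt0// pi_gt0.
have e0 (z : R) : 0 < z -> 0 < (Num.sqrt (2 * pi * z))^-1 * expR (- (u / (2 * z))).
  by move=> z0; rewrite mulr_gt0 ?expR_gt0// invr_gt0 sqrtr_gt0 mulr_gt0.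
(* Squaring clears the roots; after cancelling 2 pi and multiplying by u, the claim is r exp(- r) <
   exp(- 1) with r = u / v. *)
rewrite -(@ltr_pXn2r _ 2) ?nnegrE ?ltW ?e0//.
rewrite !exprMn !exprVn !sqr_sqrtr ?ltW ?mulr_gt0 ?pi_gt0//.
rewrite -!expRM_natl !mulrN.
rewrite (_ : 2%:R * (u / (2 * v)) = u / v); last by field; rewrite gt_eqF.
rewrite (_ : 2%:R * (u / (2 * u)) = 1); last by field; rewrite gt_eqF.
rewrite !invfM -!mulrA !ltr_pM2l ?invr_gt0 ?pi_gt0//.
have y0 : u / v - 1 != 0.
  by rewrite subr_eq0; apply: contra vu => /eqP h; rewrite -[u](divfK (lt0r_neq0 v0)) h mul1r.
have h : u / v < expR (u / v - 1) by have := expR_gt1Dx y0; rewrite addrC subrK.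
rewrite -(ltr_pM2l u0) !mulrA mulfV ?gt_eqF// mul1r.
rewrite (_ : - 1 = (u / v - 1) + - (u / v)); last by ring.
by rewrite expRD ltr_pM2r// expR_gt0.
Qed.

End maximum_likelihood.

Section maximum_likelihood_estimator.
Context {d : measure_display} {Omega : measurableType d} {R : realType}.
Variables (P : probability Omega R) (X : R -> nat -> {RV P >-> R}).
Hypothesis lX : forall s, 0 < s -> has_law P (X s 0%N) (normal_prob 0 s).

Lemma variance_estimator_mle (n : nat) : (0 < n)%N ->
  is_the_mle [set v | 0 < v]
    (fun v => distribution P (sample (X (Num.sqrt v)) n))
    (@iid_likelihood R (fun v => normal_pdf 0 (Num.sqrt v)) n)
    (@variance_estimator R n).
Proof.
move=> n0; split; first exact: measurable_variance_estimator.
move=> v v0; pose i0 := Ordinal n0.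
have mA : measurable [set x : n.-tuple R | tnth x i0 = 0].
  have := measurable_tnth i0 measurableT (measurable_set1 (0 : R)).
  by rewrite setTI.
(* One nonzero coordinate makes the estimator positive, and a Gaussian coordinate does not charge
   the point 0. *)
exists [set x : n.-tuple R | tnth x i0 = 0]; split => //.
  rewrite /= /distribution /pushforward.
  rewrite (_ : _ @^-1` _ = X (Num.sqrt v) 0%N @^-1` [set 0]); last first.
    by apply/seteqP; split => w /=; rewrite tnth_mktuple.
  have s0 : 0 < Num.sqrt v by rewrite sqrtr_gt0.
  by apply: etrans (lX _ s0 _ (measurable_set1 0)) _; rewrite /normal_prob integral_set1.
move=> x /= nx; apply: contrapT => x0; apply: nx.
have T0 : 0 < variance_estimator x.
  rewrite mulr_gt0 ?invr_gt0 ?ltr0n// (bigD1 i0)//= ltr_pwDl//.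
    by rewrite exprn_even_gt0//=; apply/eqP.
  by apply: sumr_ge0 => i _; exact: sqr_ge0.
split=> // v' v'0 v'T; rewrite !iid_likelihood_normal//.
rewrite ltr_pXn2r -?lt0n// ?nnegrE ?mulr_ge0 ?expR_ge0 ?invr_ge0//.
exact: gaussian_profile_lt.
Qed.

End maximum_likelihood_estimator.

(** * Strong consistency *)

Section strong_law.
Context {d : measure_display} {Omega : measurableType d} {R : realType}.
Variable P : probability Omega R.

(** First Borel-Cantelli lemma, with a geometric series as summable bound. *)
Lemma ae_eventually_not (F : (set Omega)^nat) (r : R) :
  (forall n, measurable (F n)) -> 0 < r < 1 ->
  (forall n, (P (F n) <= (r ^+ n)%:E)%E) ->
  {ae P, forall w, \forall n \near \oo, ~ F n w}.
Proof.
move=> mF /andP[r0 r1] Fr.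
have Foo : (\sum_(0 <= n <oo) P (F n) < +oo)%E.
  apply: (@le_lt_trans _ _ (1 / (1 - r))%:E); last exact: ltry.
  apply: lime_le; first by apply: is_cvg_nneseries.
  apply: nearW => n; apply: (@le_trans _ _ (\sum_(0 <= i < n) (r ^+ i)%:E)%E).
    by apply: lee_sum.
  rewrite sumEFin lee_fin.
  have := @geometric_le_lim R n 1 r ler01 r0.
  rewrite (ger0_norm (ltW r0)) => /(_ r1); apply: le_trans.
  by rewrite /series /=; apply: ler_sum => i _; rewrite mul1r.
exists (lim_sup_set F); split.
- apply: bigcap_measurable => // k _.
  by apply: bigcup_measurable => j _; exact: mF.
- exact: lim_sup_set_cvg0.
- move=> w /= nF n _; apply: contrapT => nFn; apply: nF.
  by exists n => // m /= nm Fm; apply: nFn; exists m.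
Qed.

Variable xi : nat -> {RV P >-> R}.
Hypothesis xi_iid : iid P xi (normal_prob 0 1).

Let S (n : nat) (w : Omega) : R := sum_of_squares n (sample xi n w).

(** The sign of [eta] selects the tail: S >= n (1 + 2 eta) when it is positive, S <= n (1 + 2 eta)
    when it is negative. *)
Lemma chernoff_sum_of_squares (eta : R) : -1 < eta -> eta != 0 ->
  exists2 r : R, 0 < r < 1 & forall n,
    (P [set w | (eta * (n%:R * (1 + 2 * eta)) <= eta * S n w)%R] <= (r ^+ n)%:E)%E.
Proof.
move=> eta1 eta0; have e1 : 0 < 1 + eta by rewrite -ltrBlDl sub0r.
(* With a^2 = 1 + eta, [c] is a positive multiple of [eta], so a single exponential Markov
   inequality serves both tails. *)
pose a : R := Num.sqrt (1 + eta).
have a0 : 0 < a by rewrite sqrtr_gt0.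
pose c : R := (1 - a ^- 2) / 2.
have cE : c = (2 * (1 + eta))^-1 * eta.
  by rewrite /c sqr_sqrtr ?ltW//; field; rewrite gt_eqF.
have k0 : 0 < (2 * (1 + eta))^-1 by rewrite invr_gt0 mulr_gt0.
pose b : R := c * (1 + 2 * eta).
exists (a * expR (- b)).
  rewrite mulr_gt0 ?expR_gt0//=.
  rewrite -(@ltr_pXn2r _ 2) ?nnegrE ?mulr_ge0 ?expR_ge0 ?(ltW a0)// expr1n.
  rewrite exprMn sqr_sqrtr ?ltW// -expRM_natl mulrN expRN ltr_pdivrMr ?expR_gt0// mul1r.
  (* The square of the ratio is (1 + eta) exp(- 2 b), and 1 + eta <= exp eta; the surplus eta^2 / (1
     + eta) in 2 b makes it strictly less than 1. *)
  rewrite (_ : 2%:R * b = eta + eta ^+ 2 / (1 + eta)); last first.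
    by rewrite /b cE; field; rewrite gt_eqF.
  apply: (le_lt_trans (expR_ge1Dx eta)); rewrite ltr_expR ltrDl.
  by rewrite divr_gt0// exprn_even_gt0.
move=> n.
have mcS : measurable_fun setT (fun w => c * S n w).
  apply: measurable_funM => //.
  exact: (measurableT_comp (measurable_sum_of_squares n)).
pose Y m : {RV P >-> R} := HB.pack_for {mfun Omega >-> R} (fun w => c * S n w)
  (isMeasurableFun.Build _ _ _ _ _ m).
have := @chernoff _ _ _ P (Y mcS) 1 (n%:R * b) ltr01.
rewrite /mmt_gen_fun unlock /=.
under eq_integral do rewrite mulr1.
have -> : (\int[P]_w (expR (c * S n w))%:E = (a ^+ n)%:E)%E.
  exact: (expectation_expR_sum_of_squares P xi xi_iid).
rewrite -EFinM mul1r exprMn -expRM_natl mulrN; apply: le_trans.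
rewrite le_eqVlt; apply/orP; left; apply/eqP; congr (P _).
have bcE w : (n%:R * b <= c * S n w) = (eta * (n%:R * (1 + 2 * eta)) <= eta * S n w).
  rewrite -[RHS](ler_pM2l k0) /b cE; congr (_ <= _); ring.
by apply/seteqP; split => w /=; rewrite bcE.
Qed.

Lemma strong_law_sum_of_squares :
  {ae P, forall w, S n w / n%:R @[n --> \oo] --> (1 : R)}.
Proof.
have mS n : measurable_fun setT (S n).
  exact: (measurableT_comp (measurable_sum_of_squares n)).
have one_side (eta : R) : -1 < eta -> eta != 0 -> {ae P, forall w,
    \forall n \near \oo, ~ (eta * (n%:R * (1 + 2 * eta)) <= eta * S n w)}.
  move=> eta1 eta0; have [r r01 Pr] := chernoff_sum_of_squares eta eta1 eta0.
  apply: (ae_eventually_not _ r _ r01 Pr) => n.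
  rewrite -[X in measurable X]setTI.
  have := measurable_fun_ler (@measurable_cst _ _ _ _ setT (eta * (n%:R * (1 + 2 * eta))))
    (measurable_funM (@measurable_cst _ _ _ _ setT eta) (mS n)).
  by move=> /(_ measurableT [set true] I).
(* Countably many levels, so that the exceptional sets unite into a null set. The deviation obtained
   is 2 eps k = 1 / (k + 2), and eps k < 1 keeps - eps k admissible in [one_side]. *)
pose eps k : R := (2 * k.+2%:R)^-1.
have eps0 k : 0 < eps k by rewrite invr_gt0 mulr_gt0.
have eps1 k : eps k < 1 by rewrite invf_lt1 ?mulr_gt0// -natrM ltr1n.
have := @ae_foralln _ _ _ P _ (fun k => one_side (eps k)
  (lt_trans (ltrN10 _) (eps0 k)) (lt0r_neq0 (eps0 k))).
have epsN k : -1 < - eps k by rewrite ltrN2.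
have epsN0 k : - eps k != 0 by rewrite oppr_eq0 lt0r_neq0.
have := @ae_foralln _ _ _ P _ (fun k => one_side (- eps k) (epsN k) (epsN0 k)).
apply: filterS2 => w wN wP; apply/cvgrPdist_lt => e e0.
have [k ke] : exists k, 2 * eps k < e.
  have [k] := ltr_add_invr e0; rewrite add0r => ke; exists k.
  apply: le_lt_trans ke; rewrite /eps invfM mulrA mulfV ?mul1r//.
  by rewrite lef_pV2 ?posrE// ler_nat.
near=> n.
have n0 : 0 < n%:R :> R by rewrite ltr0n; near: n; exact: nbhs_infty_gt.
have h1 : ~ (eps k * (n%:R * (1 + 2 * eps k)) <= eps k * S n w).
  by near: n; exact: wP.
have h2 : ~ (- eps k * (n%:R * (1 + 2 * - eps k)) <= - eps k * S n w).
  by near: n; exact: wN.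
move/negP: h1; rewrite -ltNge ltr_pM2l// mulrC -ltr_pdivrMr// => h1.
move/negP: h2; rewrite -ltNge !mulNr ltrN2 ltr_pM2l// mulrC -ltr_pdivlMr// => h2.
rewrite distrC ltr_norml; apply/andP; split; lra.
Unshelve. all: end_near. Qed.

Lemma strong_law_variance_estimator (s : R) (X : nat -> {RV P >-> R}) :
  (forall k w, X k w = s * xi k w) ->
  {ae P, forall w,
    variance_estimator (sample X n w) @[n --> \oo] --> s ^+ 2}.
Proof.
move=> XE; move: strong_law_sum_of_squares; apply: filterS => w Sw.
rewrite (_ : (fun n => _) = fun n => s ^+ 2 * (S n w / n%:R)); last first.
  apply/funext => n; rewrite /variance_estimator /S /sum_of_squares.
  rewrite [RHS]mulrA [RHS]mulrC; congr (_ * _); rewrite mulr_sumr; apply: eq_bigr => i _.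
  by rewrite !tnth_mktuple XE exprMn.
by rewrite -[X in _ --> X]mulr1; apply: cvgM => //; exact: cvg_cst.
Qed.

End strong_law.

(** * Asymptotic normality *)

Section convolution_operators.
Context {d : measure_display} {Omega : measurableType d} {R : realType}.
Variable P : probability Omega R.
Implicit Types (Y G : Omega -> R) (f g : R -> R) (C x y : R).

(** It depends on the law of [Y] only, so its powers represent sums of independent copies of [Y]
    without constructing these copies. *)
Definition convolve Y f x : R := \int[P]_w f (x + Y w).

(* A derivative-free form of "f has a Lipschitz second derivative", chosen
   because it is visibly preserved by convolution. *)
Definition taylor2 C f : Prop := exists f1 f2 : R -> R,
  [/\ measurable_fun setT f1, measurable_fun setT f2 &
    forall x y, `|f (x + y) - (f x + f1 x * y + f2 x * y ^+ 2)| <= C * `|y| ^+ 3].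

(** The class is stable under [convolve] with the same [C]: one error bound then serves all the
    replacements. *)
Definition test_function C f : Prop :=
  [/\ measurable_fun setT f, forall x, 0 <= f x <= 1 & taylor2 C f].

Lemma integrable_bounded Y K : measurable_fun setT Y -> (forall w, `|Y w| <= K) ->
  P.-integrable setT (EFin \o Y).
Proof.
move=> mY YK; apply: measurable_bounded_integrable => //.
  by rewrite /= probability_setT ltry.
exists K; split; first exact: num_real.
by move=> M KM w _ /=; apply: le_trans (ltW KM).
Qed.

Lemma measurable_translate Y g x : measurable_fun setT Y -> measurable_fun setT g ->
  measurable_fun setT (fun w => g (x + Y w)).
Proof. by move=> mY mg; apply: (measurableT_comp mg); exact: measurable_funD. Qed.

Lemma integrable_translate Y g K x : measurable_fun setT Y ->
  measurable_fun setT g -> (forall x, `|g x| <= K) ->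
  P.-integrable setT (EFin \o (fun w => g (x + Y w))).
Proof.
move=> mY mg gK; apply: (integrable_bounded _ K) => //.
exact: measurable_translate.
Qed.

Lemma measurable_convolve Y g K : measurable_fun setT Y ->
  measurable_fun setT g -> (forall x, `|g x| <= K) ->
  measurable_fun setT (convolve Y g).
Proof.
move=> mY mg gK.
(* Tonelli yields measurability for nonnegative integrands; the shift by [K] makes this one
   nonnegative and is undone at the end. *)
pose h (z : R * Omega) : \bar R := (g (z.1 + Y z.2) + K)%:E.
have mh : measurable_fun setT h.
  apply/measurable_EFinP; apply: measurable_funD => //.
  apply: (measurableT_comp mg); apply: measurable_funD => //.
  exact: (measurableT_comp mY).
have h0 z : (0 <= h z)%E.
  by rewrite lee_fin; have := gK (z.1 + Y z.2); rewrite ler_norml => /andP[]; lra.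
rewrite (_ : convolve Y g = fun x => fine (fubini_F P h x) - K).
  apply: measurable_funB => //.
  have mF := @measurable_fun_fubini_tonelli_F _ _ _ _ _ P h mh h0.
  exact: (measurableT_comp (fine_measurable measurableT) mF).
apply/funext => x.
rewrite /fubini_F /h -[fine _]/(Rintegral P setT (fun w => g (x + Y w) + K)).
rewrite RintegralD//; last 2 first.
- exact: integrable_translate gK.
- exact: finite_measure_integrable_cst.
by rewrite Rintegral_cst//= probability_setT mulr1 addrK.
Qed.

Lemma convolve_bounds Y f x : measurable_fun setT Y -> measurable_fun setT f ->
  (forall x, 0 <= f x <= 1) -> 0 <= convolve Y f x <= 1.
Proof.
move=> mY mf f01; apply/andP; split.
  by apply: Rintegral_ge0 => w _; have /andP[] := f01 (x + Y w).
have fK z : `|f z| <= 1 by rewrite ger0_norm; have /andP[] := f01 z.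
apply: (@le_trans _ _ (\int[P]_w (cst 1 w))).
  apply: le_Rintegral => //.
  - exact: integrable_translate fK.
  - exact: finite_measure_integrable_cst.
  - by move=> w _; have /andP[] := f01 (x + Y w).
by rewrite Rintegral_cst//= probability_setT mulr1.
Qed.

(** Values of f differ by at most 1, so the increments 1 and - 1 bound f1 + f2 and f2 - f1. Bounded
    coefficients are integrable after translation by a random variable. *)
Lemma taylor2_coef_bounds C f (f1 f2 : R -> R) : (forall x, 0 <= f x <= 1) ->
  (forall x y, `|f (x + y) - (f x + f1 x * y + f2 x * y ^+ 2)| <= C * `|y| ^+ 3) ->
  forall x, `|f1 x| <= C + 1 /\ `|f2 x| <= C + 1.
Proof.
move=> f01 T x; have := T x 1; have := T x (- 1).
rewrite normrN normr1 expr1n sqrrN expr1n !mulr1 mulrN1.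
have := f01 x; have := f01 (x + 1); have := f01 (x - 1).
move=> /andP[? ?] /andP[? ?] /andP[? ?]; rewrite !ler_norml.
by move=> /andP[? ?] /andP[? ?]; split; apply/andP; split; lra.
Qed.

(** The expansion is linear in f and its coefficients, so it can be averaged over translates; the
    convolved coefficients work, with the same [C]. *)
Lemma test_function_convolve C f Y : measurable_fun setT Y ->
  test_function C f -> test_function C (convolve Y f).
Proof.
move=> mY [mf f01 [f1 [f2 [mf1 mf2 T]]]].
have fK z : `|f z| <= 1 by rewrite ger0_norm; have /andP[] := f01 z.
have cK := taylor2_coef_bounds C f f1 f2 f01 T.
have f1K z : `|f1 z| <= C + 1 by have [] := cK z.
have f2K z : `|f2 z| <= C + 1 by have [] := cK z.
split; [exact: measurable_convolve fK|by move=> x; exact: convolve_bounds|].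
exists (convolve Y f1), (convolve Y f2); split.
- exact: measurable_convolve f1K.
- exact: measurable_convolve f2K.
move=> x y.
have i0 z : P.-integrable setT (EFin \o (fun w => f (z + Y w))).
  exact: integrable_translate fK.
have i1 : P.-integrable setT (EFin \o (fun w => f1 (x + Y w))).
  exact: integrable_translate f1K.
have i2 : P.-integrable setT (EFin \o (fun w => f2 (x + Y w))).
  exact: integrable_translate f2K.
have i1y := integrableZr measurableT y i1.
have i2y := integrableZr measurableT (y ^+ 2) i2.
pose r w := f (x + y + Y w) -
  (f (x + Y w) + f1 (x + Y w) * y + f2 (x + Y w) * y ^+ 2).
have i01 : P.-integrable setT (EFin \o (fun w => f (x + Y w) + f1 (x + Y w) * y)).
  exact: (integrableD measurableT (i0 x) i1y).
have i012 : P.-integrable setT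
    (EFin \o (fun w => f (x + Y w) + f1 (x + Y w) * y + f2 (x + Y w) * y ^+ 2)).
  exact: (integrableD measurableT i01 i2y).
have ir : P.-integrable setT (EFin \o r).
  exact: (integrableB measurableT (i0 (x + y)) i012).
rewrite (_ : _ - _ = \int[P]_w r w); last first.
  rewrite RintegralB// RintegralD// RintegralD// RintegralZr// RintegralZr//.
apply: (le_trans (le_normr_Rintegral measurableT ir)).
apply: (@le_trans _ _ (\int[P]_w (cst (C * `|y| ^+ 3) w))).
  apply: le_Rintegral => //.
  - exact: (integrable_norm ir).
  - exact: finite_measure_integrable_cst.
  - by move=> w _; rewrite /r addrAC; exact: T.
by rewrite Rintegral_cst//= probability_setT mulr1.
Qed.

Lemma convolve_contraction Y f g e x : measurable_fun setT Y ->
  measurable_fun setT f -> measurable_fun setT g ->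
  (forall x, 0 <= f x <= 1) -> (forall x, 0 <= g x <= 1) ->
  (forall x, `|f x - g x| <= e) -> `|convolve Y f x - convolve Y g x| <= e.
Proof.
move=> mY mf mg f01 g01 fge.
have fK z : `|f z| <= 1 by rewrite ger0_norm; have /andP[] := f01 z.
have gK z : `|g z| <= 1 by rewrite ger0_norm; have /andP[] := g01 z.
have jf := integrable_translate Y f 1 x mY mf fK.
have jg := integrable_translate Y g 1 x mY mg gK.
rewrite /convolve -RintegralB//.
have ifg := integrableB measurableT jf jg.
apply: (le_trans (le_normr_Rintegral measurableT ifg)).
apply: (@le_trans _ _ (\int[P]_w (cst e w))).
  apply: le_Rintegral => //.
  - exact: (integrable_norm ifg).
  - exact: finite_measure_integrable_cst.
by rewrite Rintegral_cst//= probability_setT mulr1.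
Qed.

Lemma convolve_taylor C f (f1 f2 : R -> R) Y x :
  measurable_fun setT Y -> measurable_fun setT f -> (forall x, 0 <= f x <= 1) ->
  (forall x y, `|f (x + y) - (f x + f1 x * y + f2 x * y ^+ 2)| <= C * `|y| ^+ 3) ->
  P.-integrable setT (EFin \o Y) ->
  P.-integrable setT (EFin \o (fun w => Y w ^+ 2)) ->
  P.-integrable setT (EFin \o (fun w => `|Y w| ^+ 3)) ->
  `|convolve Y f x -
    (f x + f1 x * \int[P]_w Y w + f2 x * \int[P]_w (Y w ^+ 2))| <=
  C * \int[P]_w (`|Y w| ^+ 3).
Proof.
move=> mY mf f01 T i1 i2 i3.
have fK z : `|f z| <= 1 by rewrite ger0_norm; have /andP[] := f01 z.
have i0 := integrable_translate Y f 1 x mY mf fK.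
have ic : P.-integrable setT (EFin \o (cst (f x))).
  exact: finite_measure_integrable_cst.
have i1x := integrableZl measurableT (f1 x) i1.
have i2x := integrableZl measurableT (f2 x) i2.
have i01 : P.-integrable setT (EFin \o (fun w => f x + f1 x * Y w)).
  exact: (integrableD measurableT ic i1x).
have i012 : P.-integrable setT (EFin \o (fun w => f x + f1 x * Y w + f2 x * Y w ^+ 2)).
  exact: (integrableD measurableT i01 i2x).
have ir := integrableB measurableT i0 i012.
rewrite (_ : _ - _ = \int[P]_w
    (f (x + Y w) - (f x + f1 x * Y w + f2 x * Y w ^+ 2))); last first.
  rewrite RintegralB// RintegralD// RintegralD// RintegralZl// RintegralZl//.
  by rewrite Rintegral_cst//= probability_setT mulr1.
apply: (le_trans (le_normr_Rintegral measurableT ir)).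
rewrite -RintegralZl//; apply: le_Rintegral => //.
- exact: (integrable_norm ir).
- exact: (integrableZl measurableT C i3).
Qed.

(** Both convolutions are close to the same quadratic expression in the common first two moments;
    the third-order remainders are what is left. *)
Lemma convolve_swap C f Y G x :
  measurable_fun setT Y -> measurable_fun setT G -> test_function C f ->
  P.-integrable setT (EFin \o Y) -> P.-integrable setT (EFin \o G) ->
  P.-integrable setT (EFin \o (fun w => Y w ^+ 2)) ->
  P.-integrable setT (EFin \o (fun w => G w ^+ 2)) ->
  P.-integrable setT (EFin \o (fun w => `|Y w| ^+ 3)) ->
  P.-integrable setT (EFin \o (fun w => `|G w| ^+ 3)) ->
  \int[P]_w Y w = \int[P]_w G w ->
  \int[P]_w (Y w ^+ 2) = \int[P]_w (G w ^+ 2) ->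
  `|convolve Y f x - convolve G f x| <=
    C * (\int[P]_w (`|Y w| ^+ 3) + \int[P]_w (`|G w| ^+ 3)).
Proof.
move=> mY mG [mf f01 [f1 [f2 [mf1 mf2 T]]]] iY iG iY2 iG2 iY3 iG3 E1 E2.
have hY := convolve_taylor C f f1 f2 Y x mY mf f01 T iY iY2 iY3.
have := convolve_taylor C f f1 f2 G x mG mf f01 T iG iG2 iG3.
rewrite -E1 -E2 distrC => hG.
rewrite mulrDr; apply: le_trans (lerD hY hG); apply: le_trans (ler_normD _ _).
by rewrite addrA subrK.
Qed.

Lemma test_function_iter C f Y n : measurable_fun setT Y ->
  test_function C f -> test_function C (iter n (convolve Y) f).
Proof.
by move=> mY tf; elim: n => //= n IH; exact: test_function_convolve.
Qed.

(* Lindeberg's replacement: exchanging the [n] factors one at a time. *)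
Lemma iter_convolve_swap C f Y G n (e : R) : 0 <= e ->
  measurable_fun setT Y -> measurable_fun setT G -> test_function C f ->
  (forall g, test_function C g -> forall x, `|convolve Y g x - convolve G g x| <= e) ->
  forall x, `|iter n (convolve Y) f x - iter n (convolve G) f x| <= n%:R * e.
Proof.
move=> e0 mY mG tf swap; elim: n => [|n IH] x /=.
  by rewrite subrr normr0 mul0r.
have [m1 b1 _] := test_function_iter C f Y n mY tf.
have tG := test_function_iter C f G n mG tf; have [m2 b2 _] := tG.
rewrite -addn1 natrD mulrDl mul1r.
(* Telescoping: T_Y^(n+1) f - T_G^(n+1) f = T_Y (T_Y^n f - T_G^n f) + (T_Y - T_G) (T_G^n f), the
   first term being controlled by contraction. *)
apply: (le_trans _ (lerD (convolve_contraction Y _ _ _ x mY m1 m2 b1 b2 IH) (swap _ tG x))).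
by apply: le_trans (ler_normD _ _); rewrite addrA subrK.
Qed.

End convolution_operators.

(** * Stability of Gaussian laws under convolution *)

Section gaussian_convolution.
Context {d : measure_display} {Omega : measurableType d} {R : realType}.
Variables (P : probability Omega R) (Z : {RV P >-> R}).
Hypothesis lZ : has_law P Z (normal_prob 0 1).
Notation mu := (@lebesgue_measure R).

Lemma measurable_scaled_rv (a : R) : measurable_fun setT (fun w => a * Z w).
Proof. exact: measurable_funM. Qed.

Lemma convolve_normal (a x : R) (f : R -> R) : 0 < a ->
  measurable_fun setT f -> (forall x, 0 <= f x <= 1) ->
  ((convolve P (fun w => a * Z w) f x)%:E = \int[normal_prob x a]_y (f y)%:E)%E.
Proof.
move=> a0 mf f01.
have mEf : measurable_fun setT (EFin \o f) by exact/measurable_EFinP.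
have f0 y : (0 <= (f y)%:E)%E by rewrite lee_fin; have /andP[] := f01 y.
have fK z : `|f z| <= 1 by rewrite ger0_norm; have /andP[] := f01 z.
have iT := integrable_translate P _ f 1 x (measurable_scaled_rv a) mf fK.
rewrite /convolve /Rintegral fineK; last exact: integrable_fin_num iT.
have := ge0_integral_normal_prob_affine a x 0 1 (EFin \o f) a0 ltr01 mEf f0.
rewrite mulr0 add0r mulr1 => <-.
rewrite -(ge0_integral_normal_law P Z _ _ (fun z => (f (a * z + x))%:E) lZ).
- by apply: eq_integral => w _; rewrite addrC.
- by apply: (measurableT_comp mEf); exact: measurable_funD.
- by move=> z; exact: f0.
Qed.

(** Bayes' rule: if y is drawn around x and z around y, the joint density is the marginal density of
    z times the conditional density of y given z, whose mean and deviation appear on the right. *)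
Lemma normal_pdf_mul (a b c x y z : R) : 0 < a -> 0 < b -> 0 < c ->
  c ^+ 2 = a ^+ 2 + b ^+ 2 ->
  normal_pdf x a y * normal_pdf y b z =
  normal_pdf x c z * normal_pdf ((b ^+ 2 * x + a ^+ 2 * z) / c ^+ 2) (a * b / c) y.
Proof.
move=> a0 b0 c0 c2.
have t0 : 0 < a * b / c by rewrite divr_gt0 ?mulr_gt0.
have peakE (u : R) : 0 < u -> normal_peak u = u^-1 * (Num.sqrt (pi *+ 2))^-1.
  move=> u0; rewrite /normal_peak -mulrnAr sqrtrM ?sqr_ge0// sqrtr_sqr.
  by rewrite gtr0_norm// invfM.
rewrite !normal_pdfE ?gt_eqF// /normal_fun !peakE//.
rewrite mulrACA [RHS]mulrACA -!expRD; congr (_ * expR _).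
  by move: (Num.sqrt _)^-1 => p; field; rewrite !gt_eqF.
have cn : c ^+ 2 != 0 by rewrite expf_neq0// gt_eqF.
rewrite !exprMn !exprVn c2 in cn *.
field.
by rewrite cn !gt_eqF.
Qed.

Lemma normal_prob_convolution (a b c x : R) (f : R -> \bar R) :
  0 < a -> 0 < b -> 0 < c -> c ^+ 2 = a ^+ 2 + b ^+ 2 ->
  measurable_fun setT f -> (forall x, 0 <= f x)%E ->
  (\int[normal_prob x a]_y \int[normal_prob y b]_z f z =
   \int[normal_prob x c]_z f z)%E.
Proof.
move=> a0 b0 c0 c2 mf f0.
pose m z := (b ^+ 2 * x + a ^+ 2 * z) / c ^+ 2.
pose h (p : measurableTypeR R * measurableTypeR R) : \bar R :=
  (f p.2 * (normal_pdf x a p.1 * normal_pdf p.1 b p.2)%:E)%E.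
have mpdf2 : measurable_fun setT
    (fun p : measurableTypeR R * measurableTypeR R => normal_pdf p.1 b p.2).
  (* As a function of the difference of the coordinates, the density is jointly measurable by
     composition. *)
  rewrite (_ : (fun p => _) = fun p => normal_pdf 0 b (p.2 - p.1)); last first.
    apply/funext => p; rewrite !normal_pdfE ?gt_eqF// /normal_fun.
    by rewrite subr0.
  apply: (measurableT_comp (measurable_normal_pdf 0 b)).
  exact: measurable_funB.
have mpdf1 : measurable_fun setT
    (fun p : measurableTypeR R * measurableTypeR R => normal_pdf x a p.1).
  exact: (measurableT_comp (measurable_normal_pdf x a)).
have mh : measurable_fun setT h.
  apply: emeasurable_funM; first exact: (measurableT_comp mf).
  by apply/measurable_EFinP; exact: measurable_funM.
have h0 p : (0 <= h p)%E.
  by rewrite mule_ge0// lee_fin mulr_ge0// normal_pdf_ge0.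
have inner y : (\int[normal_prob y b]_z f z = \int[mu]_z (f z * (normal_pdf y b z)%:E))%E.
  by apply: ge0_integral_normal_prob.
have hE y : ((\int[normal_prob y b]_z f z) * (normal_pdf x a y)%:E =
    \int[mu]_z h (y, z))%E.
  rewrite inner -ge0_integralZr//.
  - by apply: eq_integral => z _; rewrite /h /= -muleA -EFinM [(normal_pdf y _ _ * _)%R]mulrC.
  - apply: emeasurable_funM => //; apply/measurable_EFinP.
    exact: measurable_normal_pdf.
  - by move=> z _; rewrite mule_ge0// lee_fin normal_pdf_ge0.
  - by rewrite lee_fin normal_pdf_ge0.
rewrite (ge0_integral_normal_prob x c); [|exact: mf|exact: f0].
rewrite (ge0_integral_normal_prob x a); last 2 first.
- rewrite (funext inner).
  pose k (p : measurableTypeR R * measurableTypeR R) : \bar R :=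
    (f p.2 * (normal_pdf p.1 b p.2)%:E)%E.
  have mk : measurable_fun setT k.
    apply: emeasurable_funM; first exact: (measurableT_comp mf).
    exact/measurable_EFinP.
  have k0 p : (0 <= k p)%E by rewrite mule_ge0// lee_fin normal_pdf_ge0.
  exact: (@measurable_fun_fubini_tonelli_F _ _ _ _ _ mu k mk k0).
- by move=> y; apply: integral_ge0 => z _; exact: f0.
under eq_integral do rewrite hE.
(* After the exchange, the inner variable is the intermediate point y, whose conditional density
   integrates to 1. *)
rewrite (fubini_tonelli h)//.
apply: eq_integral => z _; rewrite /h /=.
under eq_integral do rewrite (normal_pdf_mul a b c x _ z a0 b0 c0 c2) EFinM muleA.
rewrite ge0_integralZl//.
- by rewrite integral_normal_pdf mule1.
- apply/measurable_EFinP; exact: measurable_normal_pdf.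
- by move=> y _; rewrite lee_fin normal_pdf_ge0.
- by rewrite mule_ge0// lee_fin normal_pdf_ge0.
Qed.

Lemma convolve_normal_comp (a b c x : R) (f : R -> R) :
  0 < a -> 0 < b -> 0 < c -> c ^+ 2 = a ^+ 2 + b ^+ 2 ->
  measurable_fun setT f -> (forall x, 0 <= f x <= 1) ->
  convolve P (fun w => a * Z w) (convolve P (fun w => b * Z w) f) x =
  convolve P (fun w => c * Z w) f x.
Proof.
move=> a0 b0 c0 c2 mf f01.
have mEf : measurable_fun setT (EFin \o f) by exact/measurable_EFinP.
have f0 y : (0 <= (EFin \o f) y)%E by rewrite lee_fin; have /andP[] := f01 y.
have fK z : `|f z| <= 1 by rewrite ger0_norm; have /andP[] := f01 z.
have mZ := measurable_scaled_rv.
apply: EFin_inj; rewrite convolve_normal//; last 2 first.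
- exact: measurable_convolve (mZ b) mf fK.
- by move=> y; exact: convolve_bounds.
rewrite (convolve_normal c x f c0 mf f01).
have := normal_prob_convolution a b c x (EFin \o f) a0 b0 c0 c2 mEf f0.
move=> <-; apply: eq_integral => y _.
exact: (convolve_normal b y f b0 mf f01).
Qed.

(** Variances add under composition. Starting from the first power keeps the scale positive. *)
Lemma iter_convolve_normal (n : nat) (b x : R) (f : R -> R) : 0 < b ->
  measurable_fun setT f -> (forall x, 0 <= f x <= 1) ->
  iter n.+1 (convolve P (fun w => b * Z w)) f x =
  convolve P (fun w => Num.sqrt n.+1%:R * b * Z w) f x.
Proof.
move=> b0 mf f01; elim: n x => [|n IH] x.
  by rewrite /= sqrtr1; under [in RHS]eq_fun do rewrite mul1r.
rewrite iterS (funext IH); apply: convolve_normal_comp => //.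
- by rewrite mulr_gt0// sqrtr_gt0.
- by rewrite mulr_gt0// sqrtr_gt0.
- by rewrite !exprMn !sqr_sqrtr// -[n.+2]addn1 natrD; ring.
Qed.

End gaussian_convolution.

(** * Sums of independent variables as iterated convolutions *)

Section sums_of_independent.
Context {d : measure_display} {Omega : measurableType d} {R : realType}.
Variable P : probability Omega R.

(** Freezing the first summand translates the remaining sum, so the induction runs over all [x].
    Equality in law with [Y] is phrased through integrals of nonnegative functions, the form in
    which Gaussian laws are used here. *)
Lemma Rintegral_sum_iter_convolve (n : nat) (W : nat -> {RV P >-> R})
    (Y : Omega -> R) (f : R -> R) :
  mutually_independent P W -> measurable_fun setT Y ->
  (forall k (g : R -> R), measurable_fun setT g -> (forall x, 0 <= g x) ->
    (\int[P]_w (g (W k w))%:E = \int[P]_w (g (Y w))%:E)%E) ->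
  measurable_fun setT f -> (forall x, 0 <= f x <= 1) ->
  forall x, \int[P]_w f (x + \sum_(i < n) W i w) = iter n (convolve P Y) f x.
Proof.
move=> + mY + mf f01.
have iter_ok m : measurable_fun setT (iter m (convolve P Y) f) /\
    forall x, 0 <= iter m (convolve P Y) f x <= 1.
  elim: m => [//|m [mI I01]] /=; split=> [|x]; last exact: convolve_bounds.
  apply: (measurable_convolve _ _ _ 1) => // z.
  by rewrite ger0_norm; have /andP[] := I01 z.
elim: n W => [|n IH] W iW WY x.
  under eq_Rintegral do rewrite big_ord0 addr0.
  by rewrite Rintegral_cst//= probability_setT mulr1.
have iW' := mutually_independent_shift _ _ iW.
pose h (z : R * n.-tuple R) : \bar R :=
  (f (x + (z.1 + \sum_(i < n) tnth z.2 i)))%:E.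
have mh : measurable_fun setT h.
  apply/measurable_EFinP; apply: (measurableT_comp mf).
  apply: measurable_funD => //; apply: measurable_funD => //.
  apply: measurable_sum => i.
  exact: (measurableT_comp (measurable_tnth i)).
have h0 z : (0 <= h z)%E.
  by rewrite lee_fin; have /andP[] := f01 (x + (z.1 + \sum_(i < n) tnth z.2 i)).
have := ge0_integral_head_sample P W n h iW mh h0; rewrite /h /=.
rewrite /Rintegral => hE.
transitivity (fine (\int[P]_w (iter n (convolve P Y) f (x + W 0%N w))%:E)).
  congr fine; transitivity (\int[P]_w (f (x + (W 0%N w +
      \sum_(i < n) tnth (sample (fun k => W k.+1) n w) i)))%:E)%E.
    apply: eq_integral => w _; rewrite big_ord_recl.
    by congr (f (_ + (_ + _)))%:E; apply: eq_bigr => i _; rewrite tnth_mktuple.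
  rewrite hE; apply: eq_integral => w _.
  rewrite -(IH _ iW' (fun k => WY k.+1)) /Rintegral fineK.
    apply: eq_integral => w' _; rewrite addrA.
    by congr (f (_ + _))%:E; apply: eq_bigr => i _; rewrite tnth_mktuple.
  apply: integrable_fin_num => //.
  have mS : measurable_fun setT (fun w => \sum_(i < n) W i.+1 w).
    by apply: measurable_sum.
  apply: (integrable_translate P _ f 1) => // z.
  by rewrite ger0_norm; have /andP[] := f01 z.
have [mI I01] := iter_ok n.
rewrite -[RHS]/(fine (\int[P]_w (iter n (convolve P Y) f (x + Y w))%:E)%E).
congr fine.
apply: (WY 0%N (fun y => iter n (convolve P Y) f (x + y))) => [|y].
  by apply: (measurableT_comp mI); exact: measurable_funD.
by have /andP[] := I01 (x + y).
Qed.

End sums_of_independent.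

(** * A step with Lipschitz second derivative *)

Section smooth_step.
Context {R : realType}.

Let cube_pos (x : R) : R := Num.max x 0 ^+ 3.

(** The coefficients are the first derivative and half the second derivative of x_+^3. Four cases,
    by the signs of x and x + y. *)
Lemma taylor2_cube_pos : taylor2 1 cube_pos.
Proof.
exists (fun x => 3 * Num.max x 0 ^+ 2), (fun x => 3 * Num.max x 0); split.
- apply: measurable_funM => //; apply: measurable_funX.
  exact: measurable_maxr.
- by apply: measurable_funM => //; exact: measurable_maxr.
move=> x y /=; rewrite mul1r /cube_pos -normrX.
have [x0|x0] := leP 0 x; have [xy0|xy0] := leP 0 (x + y).
- rewrite le_eqVlt; apply/orP; left; apply/eqP; congr `|_|; ring.
(* Here x + y < 0 <= x: the remainder is y^3 - (x + y)^3, with y^3 <= (x + y)^3 <= 0. *)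
- have y0 : y <= 0 by lra.
  have cube_le0 (u : R) : u <= 0 -> u ^+ 3 <= 0.
    by move=> u0; rewrite exprS mulr_le0_ge0 ?sqr_ge0.
  have y3 := cube_le0 _ y0; have xy3 := cube_le0 _ (ltW xy0).
  have h : 0 <= x * ((x + y) ^+ 2 + (x + y) * y + y ^+ 2).
    by apply: mulr_ge0 => //; nra.
  rewrite (ler0_norm y3) expr0n /= (_ : 0 - _ = y ^+ 3 - (x + y) ^+ 3); last by ring.
  have yxy : y ^+ 3 <= (x + y) ^+ 3.
    by rewrite -subr_ge0 (_ : _ - _ = x * ((x + y) ^+ 2 + (x + y) * y + y ^+ 2)); last ring.
  by rewrite ler_norml; apply/andP; split; lra.
- have y0 : 0 <= y by lra.
  rewrite !expr0n /= !mulr0 !mul0r !addr0 subr0 !ger0_norm ?exprn_ge0//.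
  by apply: lerXn2r; rewrite ?nnegrE//; lra.
- by rewrite !expr0n /= !mulr0 !mul0r !addr0 subr0 normr0.
Qed.

Lemma taylor2_cst (k : R) : taylor2 0 (fun=> k).
Proof.
exists (fun=> 0), (fun=> 0); split=> // x y.
by rewrite !mul0r !addr0 subrr normr0.
Qed.

Lemma taylor2D (C1 C2 : R) (f g : R -> R) :
  taylor2 C1 f -> taylor2 C2 g -> taylor2 (C1 + C2) (fun x => f x + g x).
Proof.
move=> [f1 [f2 [mf1 mf2 Tf]]] [g1 [g2 [mg1 mg2 Tg]]].
exists (fun x => f1 x + g1 x), (fun x => f2 x + g2 x); split.
- exact: measurable_funD.
- exact: measurable_funD.
move=> x y; rewrite [leRHS]mulrDl; apply: le_trans (lerD (Tf x y) (Tg x y)).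
apply: le_trans (ler_normD _ _); rewrite le_eqVlt; apply/orP; left; apply/eqP.
congr `|_|; ring.
Qed.

Lemma taylor2Z (C k : R) (f : R -> R) :
  taylor2 C f -> taylor2 (`|k| * C) (fun x => k * f x).
Proof.
move=> [f1 [f2 [mf1 mf2 T]]].
exists (fun x => k * f1 x), (fun x => k * f2 x); split.
- exact: measurable_funM.
- exact: measurable_funM.
move=> x y; rewrite -[leRHS]mulrA; apply: le_trans (ler_wpM2l (normr_ge0 k) (T x y)).
rewrite -normrM le_eqVlt; apply/orP; left; apply/eqP.
congr `|_|; ring.
Qed.

Lemma taylor2_affine (C a b : R) (f : R -> R) :
  taylor2 C f -> taylor2 (C * `|a| ^+ 3) (fun x => f (a * x + b)).
Proof.
move=> [f1 [f2 [mf1 mf2 T]]].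
have mab : measurable_fun setT (fun x : R => a * x + b).
  by apply: measurable_funD => //; exact: measurable_funM.
exists (fun x => f1 (a * x + b) * a), (fun x => f2 (a * x + b) * a ^+ 2); split.
- by apply: measurable_funM => //; exact: (measurableT_comp mf1).
- by apply: measurable_funM => //; exact: (measurableT_comp mf2).
move=> x y; rewrite -[leRHS]mulrA -[_ ^+ 3 * _]exprMn -normrM.
apply: le_trans (T (a * x + b) (a * y)).
rewrite (_ : a * (x + y) + b = a * x + b + a * y); last by ring.
rewrite le_eqVlt; apply/orP; left; apply/eqP; congr `|_|; ring.
Qed.

(* The third difference of [x_+^3], i.e. the integral of a quadratic B-spline. *)
Definition smooth_step (x : R) : R :=
  (cube_pos x - 3 * cube_pos (x - 1) + 3 * cube_pos (x - 2) - cube_pos (x - 3)) / 6.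

Lemma smooth_step_le0 (x : R) : x <= 0 -> smooth_step x = 0.
Proof.
by move=> x0; rewrite /smooth_step /cube_pos !max_r//; lra.
Qed.

Lemma smooth_step_ge3 (x : R) : 3 <= x -> smooth_step x = 1.
Proof. by move=> x3; rewrite /smooth_step /cube_pos !max_l; try lra; field. Qed.

Lemma smooth_step_bounds (x : R) : 0 <= smooth_step x <= 1.
Proof.
have [x0|x0] := leP x 0; first by rewrite smooth_step_le0// lexx ler01.
have [x3|x3] := leP 3 x; first by rewrite smooth_step_ge3// lexx ler01.
rewrite /smooth_step /cube_pos (max_l (ltW x0)) (@max_r _ _ (x - 3)); last by lra.
rewrite ler_pdivlMr// ler_pdivrMr// mul0r mul1r.
have [x1|x1] := leP 1 x; last first.
  rewrite !max_r; [|lra..]; rewrite !expr0n/=; apply/andP; split; nra.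
rewrite (@max_l _ _ (x - 1)); last by lra.
have [x2|x2] := leP 2 x; last first.
  rewrite max_r; [|lra]; rewrite !expr0n/=.
  have h1 : 0 <= (x - 1) ^+ 2 * (2 - x) by apply: mulr_ge0; [exact: sqr_ge0|lra].
  have h2 : 0 <= (2 - x) ^+ 2 * (x - 1) by apply: mulr_ge0; [exact: sqr_ge0|lra].
  have := sqr_ge0 (x - 1); have := sqr_ge0 (2 - x).
  by move=> h3 h4; apply/andP; split; lra.
rewrite max_l; [|lra]; rewrite !expr0n/=.
(* On [2, 3], six times the step is 6 - (3 - x)^3, the third difference of x^3 being the constant
   6. *)
have h1 : 0 <= (3 - x) ^+ 3 by apply: exprn_ge0; lra.
have h2 : (3 - x) ^+ 3 <= 1 by apply: exprn_ile1; lra.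
by apply/andP; split; lra.
Qed.

Lemma taylor2_smooth_step : exists C, taylor2 C smooth_step.
Proof.
have T k : taylor2 (1 * `|1| ^+ 3) (fun x => cube_pos (1 * x - k)).
  exact: taylor2_affine taylor2_cube_pos.
(* Writing [1 * x - k] gives each translate the shape of [taylor2_affine]; the constant is assembled
   by the closure rules. *)
eexists; rewrite (_ : smooth_step = fun x => 6^-1 * (cube_pos (1 * x - 0) +
    - 3 * cube_pos (1 * x - 1) + 3 * cube_pos (1 * x - 2) +
    - 1 * cube_pos (1 * x - 3))).
  apply: taylor2Z; apply: taylor2D; last by apply: taylor2Z; exact: T.
  apply: taylor2D; last by apply: taylor2Z; exact: T.
  apply: taylor2D; first exact: T.
  by apply: taylor2Z; exact: T.
by apply/funext => x; rewrite /smooth_step !mul1r subr0; ring.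
Qed.

Lemma measurable_smooth_step : measurable_fun setT smooth_step.
Proof.
have mc (k : R) : measurable_fun setT (fun x : R => cube_pos (x - k)).
  apply: measurable_funX; apply: measurable_maxr => //.
  exact: measurable_funB.
have mc0 : measurable_fun setT cube_pos.
  by apply: measurable_funX; exact: measurable_maxr.
apply: measurable_funM => //; apply: measurable_funB => //.
apply: measurable_funD; last exact: measurable_funM.
by apply: measurable_funB => //; exact: measurable_funM.
Qed.

Lemma test_function_step (a e : R) : 0 < e ->
  exists C, test_function C (fun x => 1 - smooth_step (e^-1 * x + a)).
Proof.
move=> e0; have [C TC] := taylor2_smooth_step; eexists; split.
- apply: measurable_funB => //; apply: (measurableT_comp measurable_smooth_step).
  by apply: measurable_funD => //; exact: measurable_funM.
- move=> x; have /andP[h1 h2] := smooth_step_bounds (e^-1 * x + a).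
  by apply/andP; split; lra.
rewrite (_ : (fun x => _) = fun x => 1 + - 1 * smooth_step (e^-1 * x + a)).
  apply: taylor2D; first exact: taylor2_cst.
  by apply: taylor2Z; apply: taylor2_affine; exact: TC.
by apply/funext => x; rewrite mulN1r.
Qed.

End smooth_step.

(** * Mean and third absolute moment of the standard Gaussian *)

Section odd_moments.
Context {d : measure_display} {Omega : measurableType d} {R : realType}.
Variables (P : probability Omega R) (Z : {RV P >-> R}).
Hypothesis lZ : has_law P Z (normal_prob 0 1).

Lemma ge0_integral_normal_symmetric (f : R -> \bar R) :
  measurable_fun setT f -> (forall x, 0 <= f x)%E ->
  (\int[P]_w f (- Z w)%R = \int[P]_w f (Z w))%E.
Proof.
move=> mf f0.
have mN : measurable_fun setT (fun x : R => f (- x)).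
  exact: (measurableT_comp mf).
have mpdf := measurable_normal_pdf (0 : R) 1.
rewrite (ge0_integral_normal_law P Z _ _ (fun x => f (- x)) lZ mN (fun x => f0 _)).
rewrite (ge0_integral_normal_law P Z _ _ f lZ mf f0).
rewrite (ge0_integral_normal_prob 0 1 _ mN (fun x => f0 _)).
rewrite (ge0_integral_normal_prob 0 1 _ mf f0).
pose g (x : R) : \bar R := (f x * (normal_pdf 0 1 x)%:E)%E.
have mg : measurable_fun setT g.
  by apply: emeasurable_funM => //; exact/measurable_EFinP.
have g0 x : (0 <= g x)%E by rewrite mule_ge0// lee_fin normal_pdf_ge0.
transitivity (\int[lebesgue_measure]_x g (- x)%R)%E.
  apply: eq_integral => x _; rewrite /g; congr (_ * (_)%:E)%E.
  rewrite !normal_pdfE ?oner_neq0// /normal_fun; congr (_ * expR _).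
  by rewrite !subr0 sqrrN.
pose F (x : measurableTypeR R) : measurableTypeR R := - x.
have mF : measurable_fun setT F by exact: measurable_funN.
have := @ge0_integral_pushforward _ _ (measurableTypeR R)
  (measurableTypeR R) R F mF lebesgue_measure setT g measurableT mg (fun x _ => g0 x).
rewrite preimage_setT /comp /F => <-.
by apply: eq_measure_integral => A mA _; exact: lebesgue_measureN.
Qed.

Lemma integrable_normal : P.-integrable setT (EFin \o Z).
Proof.
have i2 := integrable_normal_even_power P Z lZ 1.
have i0 := integrable_normal_even_power P Z lZ 0.
apply: (le_integrable measurableT _ _ (integrableD measurableT i0 i2)).
  exact/measurable_EFinP.
move=> w _; rewrite /= lee_fin [leRHS]ger0_norm ?addr_ge0 ?sqr_ge0// expr0.
have := sqr_ge0 (Z w - 1); have := sqr_ge0 (Z w + 1).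
by rewrite ler_norml => h1 h2; apply/andP; split; nra.
Qed.

(** By symmetry the positive and negative parts have the same integral, which is finite. *)
Lemma normal_mean : \int[P]_w Z w = 0.
Proof.
pose g (x : R) := (Num.max x 0)%:E.
have mg : measurable_fun setT g.
  by apply/measurable_EFinP; exact: measurable_maxr.
have g0 x : (0 <= g x)%E by rewrite lee_fin le_max lexx orbT.
have iZ := integrable_normal.
have ip : (\int[P]_w g (Z w))%E \is a fin_num.
  apply: integrable_fin_num => //; apply: le_integrable iZ => //.
    exact: (measurableT_comp mg).
  move=> w _; rewrite /= lee_fin ger0_norm ?le_max ?lexx ?orbT//.
  by rewrite ge_max normr_ge0 ler_norm.
rewrite /Rintegral integralE.
have -> : (\int[P]_w (fun w => (Z w)%:E)^\+ w = \int[P]_w g (Z w))%E.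
  by apply: eq_integral => w _; rewrite funeposE /g EFin_max.
have -> : (\int[P]_w (fun w => (Z w)%:E)^\- w = \int[P]_w g (- Z w)%R)%E.
  by apply: eq_integral => w _; rewrite funenegE /g EFin_max.
by rewrite (ge0_integral_normal_symmetric _ mg g0) subee.
Qed.

Lemma integrable_normal_abs3 : P.-integrable setT (EFin \o (fun w => `|Z w| ^+ 3)).
Proof.
have i2 := integrable_normal_even_power P Z lZ 1.
have i4 := integrable_normal_even_power P Z lZ 2.
apply: (le_integrable measurableT _ _ (integrableD measurableT i2 i4)).
  apply/measurable_EFinP; apply: measurable_funX.
  exact: (measurableT_comp (@normr_measurable R setT)).
move=> w _; rewrite /= lee_fin normrX normr_id [leRHS]ger0_norm.
  have -> : Z w ^+ 1.*2 = `|Z w| ^+ 2 by rewrite real_normK// num_real.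
  have -> : Z w ^+ 2.*2 = (`|Z w| ^+ 2) ^+ 2.
    by rewrite real_normK ?num_real// -exprM.
  move: `|Z w| => y.
  have := mulr_ge0 (sqr_ge0 y) (sqr_ge0 (y - 1)).
  by have := sqr_ge0 y; have := sqr_ge0 (y ^+ 2); nra.
by rewrite addr_ge0 ?sqr_ge0// (_ : 2.*2 = 2 * 2)%N// exprM sqr_ge0.
Qed.

End odd_moments.

(** * Central limit theorem for squares of Gaussians *)

Section central_limit.
Context {d : measure_display} {Omega : measurableType d} {R : realType}.
Variables (P : probability Omega R) (xi : nat -> {RV P >-> R}).
Hypothesis xi_iid : iid P xi (normal_prob 0 1).
Variables (s : R) (X : nat -> {RV P >-> R}).
Hypothesis s0 : 0 < s.
Hypothesis XE : forall k w, X k w = s * xi k w.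

Let Z := xi 0%N.
Let lZ : has_law P Z (normal_prob 0 1) := xi_iid.2 0%N.
(** The normalized error is a multiple of the sum of the D (xi i). The variance of D (Z) is 3 - 2 +
    1 = 2, the origin of the 2 in 2 sigma^4. *)
Let D (x : R) : R := x ^+ 2 - 1.

Let even_power k := integrable_normal_even_power P Z lZ k.

Let moment0 : \int[P]_w (Z w ^+ 0.*2) = 1.
Proof.
under eq_Rintegral do rewrite expr0.
by rewrite Rintegral_cst//= probability_setT mulr1.
Qed.

Let moment2 : \int[P]_w (Z w ^+ 2) = 1.
Proof.
by have := normal_moment_rec P Z lZ 0; rewrite moment0 mulr1.
Qed.

Let moment4 : \int[P]_w (Z w ^+ 4) = 3.
Proof.
have := normal_moment_rec P Z lZ 1.
by rewrite (_ : 1.*2 = 2)%N// moment2 mulr1.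
Qed.

Let integrable_cst1 (c : R) : P.-integrable setT (EFin \o cst c).
Proof. exact: finite_measure_integrable_cst. Qed.

Let iD : P.-integrable setT (EFin \o (fun w => D (Z w))).
Proof. exact: (integrableB measurableT (even_power 1) (integrable_cst1 1)). Qed.

Let mean_D : \int[P]_w D (Z w) = 0.
Proof.
rewrite /D (RintegralB measurableT (even_power 1) (integrable_cst1 1)).
by rewrite moment2 (Rintegral_cst _ measurableT)/= probability_setT mulr1 subrr.
Qed.

Let D2E w : D (Z w) ^+ 2 = Z w ^+ 4 - 2 * Z w ^+ 2 + 1.
Proof. by rewrite /D; ring. Qed.

Let i42 : P.-integrable setT (EFin \o (fun w => Z w ^+ 4 - 2 * Z w ^+ 2)).
Proof.
exact: (integrableB measurableT (even_power 2)
  (integrableZl measurableT 2 (even_power 1))).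
Qed.

Let iD2 : P.-integrable setT (EFin \o (fun w => D (Z w) ^+ 2)).
Proof.
rewrite (funext D2E); exact: (integrableD measurableT i42 (integrable_cst1 1)).
Qed.

Let mean_D2 : \int[P]_w (D (Z w) ^+ 2) = 2.
Proof.
rewrite (funext D2E) (RintegralD measurableT i42 (integrable_cst1 1)).
rewrite (RintegralB measurableT (even_power 2)
  (integrableZl measurableT 2 (even_power 1))).
rewrite (RintegralZl _ measurableT (even_power 1)).
rewrite moment4 moment2 (Rintegral_cst _ measurableT)/= probability_setT /=; ring.
Qed.

Let mD : measurable_fun setT D.
Proof. by apply: measurable_funB => //; exact: measurable_funX. Qed.

Let mDZ : measurable_fun setT (fun w => D (Z w)).
Proof. exact: (measurableT_comp mD). Qed.

Let iD3 : P.-integrable setT (EFin \o (fun w => `|D (Z w)| ^+ 3)).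
Proof.
have := integrableZl measurableT 4
  (integrableD measurableT (integrable_cst1 1) (even_power 3)).
apply: le_integrable => //.
  apply/measurable_EFinP; apply: measurable_funX.
  exact: (measurableT_comp (@normr_measurable R setT)).
have Z6 w : 0 <= Z w ^+ 3.*2 by rewrite (_ : 3.*2 = 2 * 3)%N// exprM exprn_ge0 ?sqr_ge0.
move=> w _; rewrite /= lee_fin normrX normr_id [leRHS]ger0_norm; last first.
  by rewrite mulr_ge0// addr_ge0.
rewrite (_ : 3.*2 = 2 * 3)%N// exprM /D; have := sqr_ge0 (Z w).
move: (Z w ^+ 2) => y y0.
(* |y - 1| <= 1 + y, and 4 (1 + y^3) - (1 + y)^3 = 3 (1 + y) (y - 1)^2, whence the factor 4. *)
apply: (@le_trans _ _ ((1 + y) ^+ 3)).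
  by apply: lerXn2r; rewrite ?nnegrE ?addr_ge0// ler_norml; apply/andP; split; lra.
by have := mulr_ge0 (addr_ge0 y0 ler01) (sqr_ge0 (y - 1)); nra.
Qed.

Let integrable_scale (b : R) (F : Omega -> R) :
  P.-integrable setT (EFin \o F) -> P.-integrable setT (EFin \o (fun w => b * F w)).
Proof. exact: integrableZl. Qed.

Let tau : R := Num.sqrt 2 * s ^+ 2.

Lemma cvg_test_function_normalized_error (C : R) (f : R -> R) : test_function C f ->
  \int[P]_w f (normalized_error X (s ^+ 2) n w) @[n --> \oo] -->
  \int[P]_w f (tau * Z w).
Proof.
move=> tf; have [mf f01 [f1 [f2 [_ _ T]]]] := tf.
have C0 : 0 <= C.
  by have := le_trans (normr_ge0 _) (T 0 1); rewrite normr1 expr1n mulr1.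
have mZ : measurable_fun setT (Z : Omega -> R) by [].
(* The coefficient of one summand at sample size n + 1; [cvg_shiftS] disposes of the empty
   sample. *)
pose b n : R := s ^+ 2 / Num.sqrt n.+1%:R.
have b0 n : 0 < b n by rewrite divr_gt0 ?exprn_gt0// sqrtr_gt0.
have q0 : 0 < Num.sqrt 2 :> R by rewrite sqrtr_gt0.
pose Y n w := b n * D (Z w).
(* Gaussian with the moments of [Y n]: mean zero and variance 2 (b n)^2. *)
pose G n w := b n * Num.sqrt 2 * Z w.
pose M := \int[P]_w (`|D (Z w)| ^+ 3).
pose K := \int[P]_w (`|Z w| ^+ 3).
have mY n : measurable_fun setT (Y n) by exact: measurable_funM.
have mG n : measurable_fun setT (G n) by exact: measurable_funM.
have swap n g : test_function C g -> forall x,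
    `|convolve P (Y n) g x - convolve P (G n) g x| <=
    C * (b n ^+ 3 * M + (b n * Num.sqrt 2) ^+ 3 * K).
  move=> tg x.
  have Y2E w : Y n w ^+ 2 = b n ^+ 2 * D (Z w) ^+ 2 by rewrite exprMn.
  have G2E w : G n w ^+ 2 = (b n * Num.sqrt 2) ^+ 2 * Z w ^+ 2 by rewrite exprMn.
  have Y3E w : `|Y n w| ^+ 3 = b n ^+ 3 * `|D (Z w)| ^+ 3.
    by rewrite normrM exprMn gtr0_norm.
  have G3E w : `|G n w| ^+ 3 = (b n * Num.sqrt 2) ^+ 3 * `|Z w| ^+ 3.
    by rewrite normrM exprMn gtr0_norm// mulr_gt0.
  have iZ1 := integrable_normal P Z lZ; have iZ3 := integrable_normal_abs3 P Z lZ.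
  have := convolve_swap P C g (Y n) (G n) x (mY n) (mG n) tg
    (integrable_scale _ _ iD) (integrable_scale _ _ iZ1).
  rewrite (funext Y2E) (funext G2E) (funext Y3E) (funext G3E).
  move=> /(_ (integrable_scale _ _ iD2) (integrable_scale _ _ (even_power 1))
    (integrable_scale _ _ iD3) (integrable_scale _ _ iZ3)).
  rewrite !RintegralZl//; last exact: (even_power 1).
  apply; first by rewrite mean_D (normal_mean P Z lZ) !mulr0.
  by rewrite mean_D2 moment2 mulr1 [RHS]exprMn sqr_sqrtr.
have main n : `|\int[P]_w f (normalized_error X (s ^+ 2) n.+1 w) -
    \int[P]_w f (tau * Z w)| <=
    n.+1%:R * (C * (b n ^+ 3 * M + (b n * Num.sqrt 2) ^+ 3 * K)).
  have mW k : measurable_fun setT (fun w => b n * D (xi k w)).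
    by apply: measurable_funM => //; exact: (measurableT_comp mD).
  pose W k m : {RV P >-> R} := HB.pack_for {mfun Omega >-> R}
    (fun w => b n * D (xi k w)) (isMeasurableFun.Build _ _ _ _ _ m).
  have iW : mutually_independent P (fun k => W k (mW k)).
    apply: (mutually_independent_comp P xi _ (fun=> fun x => b n * D x)) xi_iid.1 => //.
    by move=> k; exact: measurable_funM.
  have sumE w : normalized_error X (s ^+ 2) n.+1 w = 0 + \sum_(i < n.+1) W i (mW i) w.
    rewrite add0r /normalized_error /variance_estimator -mulr_sumr.
    under eq_bigr do rewrite tnth_mktuple XE exprMn.
    rewrite -mulr_sumr sumrB sumr_const card_ord.
    have r0 : 0 < Num.sqrt n.+1%:R :> R by rewrite sqrtr_gt0.
    have r2 : n.+1%:R = Num.sqrt n.+1%:R ^+ 2 :> R by rewrite sqr_sqrtr.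
    move: r0 r2; rewrite /b; move: (Num.sqrt _) => r r0 ->.
    by field; rewrite gt_eqF.
  have WY k (g : R -> R) : measurable_fun setT g -> (forall x, 0 <= g x) ->
      (\int[P]_w (g (W k (mW k) w))%:E = \int[P]_w (g (Y n w))%:E)%E.
    move=> mg g0.
    have mh : measurable_fun setT (fun x : R => (g (b n * D x))%:E).
      apply/measurable_EFinP; apply: (measurableT_comp mg).
      exact: measurable_funM.
    have h0 x : (0 <= (g (b n * D x))%:E)%E by rewrite lee_fin.
    pose h x := (g (b n * D x))%:E.
    rewrite (ge0_integral_normal_law P (xi k) _ _ h (xi_iid.2 k) mh h0).
    by rewrite (ge0_integral_normal_law P Z _ _ h lZ mh h0).
  rewrite (_ : (fun w => f (normalized_error X (s ^+ 2) n.+1 w)) =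
     fun w => f (0 + \sum_(i < n.+1) W i (mW i) w)); last first.
    by apply/funext => w; rewrite sumE.
  rewrite (Rintegral_sum_iter_convolve P n.+1 _ (Y n) f iW (mY n) WY mf f01).
  (* As sqrt (n + 1) * b n * sqrt 2 = tau, the Gaussian side does not depend on n: it is already the
     limit. *)
  have -> : \int[P]_w f (tau * Z w) = iter n.+1 (convolve P (G n)) f 0.
    rewrite (iter_convolve_normal P Z lZ n _ 0 f) ?mulr_gt0// /convolve.
    apply: eq_Rintegral => w _; rewrite add0r; congr (f (_ * _)).
    by rewrite /tau /b; field; rewrite gt_eqF// sqrtr_gt0.
  apply: (iter_convolve_swap P C f _ _ n.+1 _ _ (mY n) (mG n) tf (swap n)).
  have M0 : 0 <= M by apply: Rintegral_ge0 => w _; rewrite exprn_ge0.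
  have K0 : 0 <= K by apply: Rintegral_ge0 => w _; rewrite exprn_ge0.
  by rewrite mulr_ge0// addr_ge0// mulr_ge0// exprn_ge0// ltW// mulr_gt0.
(* Each of the n + 1 replacements costs order (n + 1)^(-3/2), so the total is of order (n +
   1)^(-1/2). *)
have bE n : n.+1%:R * (C * (b n ^+ 3 * M + (b n * Num.sqrt 2) ^+ 3 * K)) =
    C * s ^+ 6 * (M + Num.sqrt 2 ^+ 3 * K) * (Num.sqrt n.+1%:R)^-1.
  have r0 : 0 < Num.sqrt n.+1%:R :> R by rewrite sqrtr_gt0.
  have -> : n.+1%:R = Num.sqrt n.+1%:R ^+ 2 :> R by rewrite sqr_sqrtr.
  by rewrite /b !sqrtr_sqr ger0_norm ?sqrtr_ge0//; field; rewrite gt_eqF.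
have cvg0 : C * s ^+ 6 * (M + Num.sqrt 2 ^+ 3 * K) * (Num.sqrt n.+1%:R)^-1
    @[n --> \oo] --> (0 : R).
  rewrite -[X in _ --> X](mulr0 (C * s ^+ 6 * (M + Num.sqrt 2 ^+ 3 * K))).
  apply: cvgM; first exact: cvg_cst.
  rewrite (_ : (fun n => _) = fun n => Num.sqrt (@harmonic R n)).
    rewrite -[X in _ --> X](@sqrtr0 R).
    exact: (continuous_cvg _ (@sqrt_continuous R 0) cvg_harmonic).
  by apply/funext => n; rewrite sqrtrV.
rewrite -cvg_shiftS; apply/cvgrPdist_le => e e0.
move/cvgrPdist_le : cvg0 => /(_ e e0); apply: filterS => n.
rewrite sub0r normrN => he; rewrite distrC; apply: le_trans (main n) _.
by rewrite bE; apply: le_trans he; exact: ler_norm.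
Qed.

(** Equal to 1 up to [a] and to 0 from [a + 3 * e] on, as the ramp of [smooth_step] has length 3. *)
Let step (a e : R) (x : R) : R := 1 - smooth_step (e^-1 * x + - (e^-1 * a)).

Let cdf_step_bounds (V : {RV P >-> R}) (a e : R) : 0 < e ->
  fine (cdf V a) <= \int[P]_w step a e (V w) <= fine (cdf V (a + 3 * e)).
Proof.
move=> e0.
have stepE x : step a e x = 1 - smooth_step ((x - a) / e).
  by rewrite /step; congr (1 - smooth_step _); ring.
have [C [ms s01 _]] := test_function_step (- (e^-1 * a)) e e0.
have mV c : measurable (V @^-1` `]-oo, c]).
  by rewrite -[X in measurable X]setTI; exact: measurable_funPT.
have cdfE c : fine (cdf V c) = \int[P]_w (\1_(V @^-1` `]-oo, c]) w).
  by rewrite /Rintegral integral_indic// setIT.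
have iI c : P.-integrable setT (EFin \o \1_(V @^-1` `]-oo, c])).
  exact: integrable_indic.
have iS : P.-integrable setT (EFin \o (fun w => step a e (V w))).
  apply: (integrable_bounded P _ 1); first exact: (measurableT_comp ms).
  by move=> w; rewrite ger0_norm; have /andP[] := s01 (V w).
rewrite !cdfE; apply/andP; split; apply: le_Rintegral => // w _.
- rewrite indicE; have [|_] := boolP (w \in _); last by have /andP[] := s01 (V w).
  rewrite inE /= in_itv /= => Va.
  rewrite stepE smooth_step_le0 ?subr0//.
  by rewrite pmulr_lle0 ?invr_gt0// subr_le0.
- rewrite indicE; have [_|] := boolP (w \in _); first by have /andP[] := s01 (V w).
  move=> /negP; rewrite inE /= in_itv /= => /negP; rewrite -ltNge => Va.
  rewrite stepE smooth_step_ge3 ?subrr//.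
  by rewrite ler_pdivlMr// lerBrDl ltW.
Qed.

Lemma central_limit_variance_estimator :
  cvg_in_distribution P (fun n => normalized_error X (s ^+ 2) n)
    (normal_prob 0 (Num.sqrt (2 * s ^+ 4))).
Proof.
have tauE : Num.sqrt (2 * s ^+ 4) = tau * 1.
  rewrite sqrtrM// (_ : s ^+ 4 = (s ^+ 2) ^+ 2) ?sqrtr_sqr ?ger0_norm ?sqr_ge0 ?mulr1//.
  by rewrite -exprM.
have tau0 : 0 < tau by rewrite mulr_gt0 ?exprn_gt0// sqrtr_gt0.
(* The limit law is realized on [Omega] itself, so that [cdf_step_bounds] applies to it as well as
   to the errors. *)
pose V : {RV P >-> R} := (cst tau \* Z)%R.
have lV := has_law_scale P Z V tau 1 tau0 ltr01 (fun _ => erefl) lZ.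
rewrite tauE => x; set m := normal_prob 0 (tau * 1) => cm.
have mE r : m `]-oo, r]%classic = cdf V r by rewrite /cdf lV.
have cdf_fin (W : {RV P >-> R}) r : cdf W r \is a fin_num.
  by rewrite /cdf fin_num_measure.
pose F r := fine (cdf V r).
have FE r : m `]-oo, r]%classic = (F r)%:E by rewrite /F fineK ?mE.
have cF : F r @[r --> x] --> F x.
  by apply: fine_cvg; rewrite -FE; move: cm; rewrite /continuous_at (funext mE).
rewrite FE; apply/fine_cvgP; split.
  by apply: nearW => n; exact: cdf_fin.
apply/cvgrPdist_le => e e0.
have e20 : 0 < e / 2 by rewrite divr_gt0.
move/cvgrPdist_le : cF => /(_ _ e20) [r /= r0 Fr].
(* The ramps have length 3 dl = r / 2, within the continuity radius [r] at [x]. *)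
have d0 : 0 < r / 6 by rewrite divr_gt0.
pose dl := r / 6.
have Fnear y : `|x - y| < r -> `|F x - F y| <= e / 2 by exact: Fr.
have Fu : `|F x - F (x + 3 * dl)| <= e / 2.
  apply: Fnear; rewrite (_ : x - _ = - (r / 2)); last by rewrite /dl; field.
  by rewrite normrN gtr0_norm; lra.
have Fl : `|F x - F (x - 3 * dl)| <= e / 2.
  apply: Fnear; rewrite (_ : x - _ = r / 2); last by rewrite /dl; field.
  by rewrite gtr0_norm; lra.
(* A ramp starting at [x] bounds the distribution function at [x] from above, and one ending at [x]
   bounds it from below; each side loses e / 2 by convergence and e / 2 by continuity. *)
have [Cu tu] := test_function_step (- (dl^-1 * x)) dl d0.
have [Cl tl] := test_function_step (- (dl^-1 * (x - 3 * dl))) dl d0.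
have cvg_step C a : test_function C (step a dl) ->
    \int[P]_w step a dl (normalized_error X (s ^+ 2) n w) @[n --> \oo] -->
    \int[P]_w step a dl (V w).
  exact: cvg_test_function_normalized_error.
have /cvgrPdist_le/(_ _ e20) := cvg_step _ _ tu.
have /cvgrPdist_le/(_ _ e20) := cvg_step _ _ tl.
apply: filterS2 => n hl hu; set NE := normalized_error X (s ^+ 2) n.
have /andP[nu _] := cdf_step_bounds NE x dl d0.
have /andP[_ nl] := cdf_step_bounds NE (x - 3 * dl) dl d0.
have /andP[_ vu] := cdf_step_bounds V x dl d0.
have /andP[vl _] := cdf_step_bounds V (x - 3 * dl) dl d0.
rewrite subrK in nl; rewrite -/(F _) in vu; rewrite -/(F _) in vl.
rewrite -/(F x); move: nu nl vu vl hl hu Fu Fl; rewrite !ler_norml.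
move: (fine (cdf NE x)) (F x) (F (x + 3 * dl)) (F (x - 3 * dl)).
move: (\int[P]_w step x dl (NE w)) (\int[P]_w step x dl (V w)).
move: (\int[P]_w step (x - 3 * dl) dl (NE w)).
move: (\int[P]_w step (x - 3 * dl) dl (V w)).
move=> i1 i2 i3 i4 c f1 f2 f3 h1 h2 h3 h4.
move=> /andP[? ?] /andP[? ?] /andP[? ?] /andP[? ?].
by apply/andP; split; lra.
Qed.

End central_limit.

Theorem theorem3p5 (R : realType) (d : measure_display)
    (Omega : measurableType d) (P : probability Omega R)
    (theta sigma : R) (mu q u0 : nat -> R) (xi : nat -> {RV P >-> R}) (t : R)
    (theta_gt0 : 0 < theta) (sigma_gt0 : 0 < sigma)
    (mu_gt0 : forall k, 0 < mu k) (q_gt0 : forall k, 0 < q k)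
    (xi_iid : iid P xi (normal_prob 0 1))
    (t_gt0 : 0 < t) :
  let Theta : set R := [set v | 0 < v] in
  let properties (X : R -> nat -> {RV P >-> R}) :=
    let Q (N : nat) (v : R) : probability (N.-tuple R) R :=
      distribution P (sample (X (Num.sqrt v)) N) in
    [/\ iid P (X sigma) (normal_prob 0 sigma),
        forall N : nat, (0 < N)%N ->
          is_the_mle Theta (Q N)
            (@iid_likelihood R (fun v : R => normal_pdf 0 (Num.sqrt v)) N)
            (@variance_estimator R N),
        forall N : nat, (0 < N)%N ->
          is_the_mvue Theta (Q N) (@variance_estimator R N),
        {ae P, forall w,
          variance_estimator (sample (X sigma) N w) @[N --> \oo]
            --> sigma ^+ 2} &
        cvg_in_distribution P
          (fun N => normalized_error (X sigma) (sigma ^+ 2) N)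
          (normal_prob 0 (Num.sqrt (2 * sigma ^+ 4)))] in
  ((forall k, u0 k = 0) ->
     properties (fun s k => observation theta mu q u0 xi s t k)) /\
  properties (fun s k => centered_observation theta mu q u0 xi s t k).
Proof.
move=> Theta properties.
(* Both kinds of observation equal [s * xi k] pointwise, the uncentered one when the initial values
   vanish; the five properties are derived from this identity. *)
have key (X : R -> nat -> {RV P >-> R}) :
    (forall s k w, X s k w = s * xi k w) -> properties X.
  move=> XE.
  have lX s : 0 < s -> forall k, has_law P (X s k) (normal_prob 0 s).
    move=> s0 k; rewrite -[s in normal_prob _ s]mulr1.
    exact: (has_law_scale P (xi k) _ s 1 s0 ltr01 (XE s k) (xi_iid.2 k)).
  split.
  - split; last exact: lX.
    apply: (mutually_independent_comp P xi _ (fun=> *%R sigma)) xi_iid.1 => [k|k w].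
      exact: measurable_funM.
    exact: XE.
  - move=> N N0; apply: variance_estimator_mle => // s s0; exact: lX.
  - move=> N N0; exact: (variance_estimator_mvue P xi xi_iid X XE).
  - exact: (strong_law_variance_estimator P xi xi_iid sigma _ (XE sigma)).
  - exact: (central_limit_variance_estimator P xi xi_iid sigma _ sigma_gt0 (XE sigma)).
split=> [u00|]; apply: key => s k w.
- by rewrite [LHS]observationE// u00 mulr0 mul0r subr0.
- exact: centered_observationE.
Qed.
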